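(* Let $n\ge1$, $\beta\in(0,1)$, $\alpha\in(0,1-\beta)$, $\tau>0$, $\eta\in[0,1)$, $I=[\sqrt{1-\eta}\,\tau,\tau]$ and $\sigma\in I$. Let $\{S_m,m\in\mathcal M_n\}$ be a finite family of linear subspaces of $\mathbb R^n$ and $(\beta_m)_{m\in\mathcal M_n}$ numbers in $(0,1)$ such that the index $n$ belongs to $\mathcal M_n$, $S_n=\mathbb R^n$, $\dim S_m<n$ for $m\neq n$, and $\sum_{m\in\mathcal M_n}\beta_m\le\beta$. Let $\hat f,\hat\rho,\rho_m$ be constructed from these data (not using $\sigma$) and from $Y$ as described in the context. Then $\mathcal B(\hat f,\hat\rho)$ is a confidence ball with probability of coverage $1-\beta$, i.e. $$\mathbb P_{f,\sigma}[f\in\mathcal B(\hat f,\hat\rho)]\ge1-\beta\qquad\text{for all } f\in\mathbb R^n .$$ Moreover, for each $m\in\mathcal M_n$, $$\inf_{f\in S_m}\mathbb P_{f,\sigma}[\hat\rho\le\rho_m]\ge1-\alpha .$$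
   Context: $\mathbb P_{f,\sigma}$ is the law of $Y=f+\sigma\varepsilon$ with $f\in\mathbb R^n$ and $\varepsilon$ standard Gaussian in $\mathbb R^n$ (mean $0$, identity covariance). $\|\cdot\|$ is the Euclidean norm on $\mathbb R^n$; $\Pi_S$ is the orthogonal projector onto a linear subspace $S$; $\mathcal B(x,r)$ is the (closed) Euclidean ball with center $x$ and radius $r$. For $z\ge0$ and integer $d\ge1$, $\chi^2_{z,d}(\cdot)$ is the distribution function of the noncentral $\chi^2$ distribution with $d$ degrees of freedom and noncentrality parameter $z$ (the law of $\|\mu+\xi\|^2$ with $\xi$ standard Gaussian in $\mathbb R^d$ and $\|\mu\|^2=z$, of mean $z+d$), and $q_{z,d}(u)$ is its $(1-u)$-quantile: if $X$ has this law then $\mathbb P(X\ge q_{z,d}(u))=u$ for $u\in(0,1)$. Conventions: $q_{0,d}(1)=-\infty$ and $q_{z,0}(u)=0$. $a\wedge b=\min(a,b)$. Construction. Put $\mathcal D_m=\dim S_m$ and $N_m=n-\mathcal D_m$. Radii $\rho_m\ge0$: for $m=n$, $\rho_n^2=q_{0,n}(\beta_n)\tau^2$. For $m\ne n$ with $\mathcal D_m\ne0$, $$\rho_m^2=\sup_{z\ge0,\ s\in I}\left[z s^2+q_{0,\mathcal D_m}\left(\frac{\beta_m}{\chi^2_{z,N_m}(q_{0,N_m}(\alpha)\tau^2/s^2)}\wedge1\right)s^2\right].$$ For $m\ne n$ with $\mathcal D_m=0$, $$\rho_m^2=\inf\Big\{x\ge0:\ \sup_{s\in I}\chi^2_{x/s^2,n}\big(q_{0,n}(\alpha)\tau^2/s^2\big)\le\beta_m\Big\}.$$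 Estimators: $\hat f_m=\Pi_{S_m}Y$ for $m\in\mathcal M_n$ (so $\hat f_n=Y$). Selection: $\mathcal A=\{m\in\mathcal M_n:\ \|Y-\hat f_m\|^2\le q_{0,N_m}(\alpha)\tau^2\}$ (which contains $n$, since $N_n=0$), $\hat m\in\arg\min_{m\in\mathcal A}\rho_m$ (ties broken by any fixed rule), $\hat\rho=\rho_{\hat m}$, $\hat f=\hat f_{\hat m}$. *)

(* Defs.v *)
From HB Require Import structures.
From mathcomp Require Import all_boot all_order all_algebra.
From mathcomp Require Import all_classical all_reals all_analysis.
From mathcomp Require Import measurable_realfun.

Set Implicit Arguments.
Unset Strict Implicit.
Unset Printing Implicit Defensive.

Import Order.TTheory GRing.Theory Num.Theory.
Import numFieldNormedType.Exports.

Local Open Scope classical_set_scope.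
Local Open Scope ring_scope.

(** The library puts the sup norm on ['rV[R]_n]; the Euclidean structure is
    defined here. *)

Definition dotv (R : realType) (n : nat) (x y : 'rV[R]_n) : R :=
  \sum_(i < n) x 0 i * y 0 i.

Definition enorm (R : realType) (n : nat) (x : 'rV[R]_n) : R :=
  Num.sqrt (dotv x x).

Definition eball (R : realType) (n : nat) (x : 'rV[R]_n) (r : R) :
    set 'rV[R]_n :=
  [set y | enorm (y - x) <= r].

Definition orthoproj (R : realType) (n : nat) (S : {vspace 'rV[R]_n})
    (x : 'rV[R]_n) : 'rV[R]_n :=
  xget 0 [set p | p \in S /\ forall v, v \in S -> dotv (x - p) v = 0].

Lemma dotvE (R : realType) (n : nat) (x y : 'rV[R]_n) :
  dotv x y = (x *m y^T) 0 0.
Proof. by rewrite !mxE; apply: eq_bigr => i _; rewrite !mxE. Qed.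

Lemma dotvv_eq0 (R : realType) (n : nat) (x : 'rV[R]_n) :
  dotv x x = 0 -> x = 0.
Proof.
move=> /eqP; rewrite /dotv psumr_eq0; last first.
  by move=> i _; rewrite -expr2 sqr_ge0.
move=> /allP xx0; apply/rowP => i; rewrite mxE.
have /= := xx0 i (mem_index_enum i).
by rewrite mulf_eq0 orbb => /eqP.
Qed.

(* [orthoproj] is well defined: the set in its definition is a singleton. *)
Lemma orthoprojP (R : realType) (n : nat) (S : {vspace 'rV[R]_n})
    (x : 'rV[R]_n) :
  orthoproj S x \in S /\ forall v, v \in S -> dotv (x - orthoproj S x) v = 0.
Proof.
suff [p pP] : exists p, p \in S /\ forall v, v \in S -> dotv (x - p) v = 0.
  by rewrite /orthoproj; case: xgetP => [y _ //|/(_ p)].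
pose B : 'M[R]_(\dim S, n) := \matrix_(i, j) (vbasis S)`_i 0 j.
have rowB i : row i B = (vbasis S)`_i by apply/rowP => j; rewrite !mxE.
have mulB (u : 'rV[R]_(\dim S)) : u *m B = \sum_i u 0 i *: (vbasis S)`_i.
  by rewrite mulmx_sum_row; apply: eq_bigr => i _; rewrite rowB.
have uBS (u : 'rV[R]_(\dim S)) : u *m B \in S.
  rewrite mulB; apply: memv_suml => i _; apply: memvZ; apply: vbasis_mem.
  by rewrite mem_nth// size_tuple.
have SuB v : v \in S -> exists u : 'rV[R]_(\dim S), v = u *m B.
  move=> /coord_vbasis vE; exists (\row_i coord (vbasis S) i v).
  by rewrite mulB [LHS]vE; apply: eq_bigr => i _; rewrite mxE.
have BBu : B *m B^T \in unitmx.
  rewrite -row_free_unit -kermx_eq0; apply/eqP/row_matrixP => i.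
  rewrite row0; set u := row i _.
  have uG : u *m (B *m B^T) = 0.
    by apply/sub_kermxP; rewrite row_sub.
  have uB0 : u *m B = 0.
    apply: dotvv_eq0; rewrite dotvE trmx_mul mulmxA -(mulmxA u) uG.
    by rewrite mul0mx mxE.
  have /freeP fB := basis_free (vbasisP S).
  apply/rowP => j; rewrite [RHS]mxE.
  by apply: (fB (fun k => u 0 k)); rewrite -mulB.
exists (x *m B^T *m invmx (B *m B^T) *m B); split; first exact: uBS.
move=> v /SuB[u ->]; rewrite dotvE trmx_mul mulmxA mulmxBl.
by rewrite -(mulmxA _ B) mulmxKV// subrr mul0mx mxE.
Qed.

(** The product (Borel) sigma-algebra on row vectors, generated by the
    coordinates, as in the library for [n.-tuple T]. *)

Definition measure_row_display : measure_display -> measure_display.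
Proof. exact. Qed.

Section measurable_row.
Context (R : realType) (n : nat).

Let coors : 'I_n -> 'rV[R]_n -> R := fun i x => x 0 i.

Let row_set0 : g_sigma_preimage coors set0.
Proof. exact: sigma_algebra0. Qed.

Let row_setC A : g_sigma_preimage coors A -> g_sigma_preimage coors (~` A).
Proof. exact: sigma_algebraC. Qed.

Let row_bigcup (F : _^nat) : (forall i, g_sigma_preimage coors (F i)) ->
  g_sigma_preimage coors (\bigcup_i (F i)).
Proof. exact: sigma_algebra_bigcup. Qed.

HB.instance Definition _ := @isMeasurable.Build
  (measure_row_display default_measure_display) 'rV[R]_n
  (g_sigma_preimage coors) row_set0 row_setC row_bigcup.

End measurable_row.

Lemma measurable_coord (R : realType) (n : nat) (i : 'I_n) :
  measurable_fun [set: 'rV[R]_n] (fun x : 'rV[R]_n => x 0 i).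
Proof.
move=> _ Y mY; rewrite setTI; apply: sub_sigma_algebra => /=.
rewrite -bigcup_seq/=; exists i => /=; first by rewrite mem_index_enum.
by exists Y => //; rewrite setTI.
Qed.

Lemma measurable_fun_rowP d (T : measurableType d) (R : realType) (n : nat)
    (f : T -> 'rV[R]_n) :
  (forall i, measurable_fun [set: T] (fun t => f t 0 i)) ->
  measurable_fun [set: T] f.
Proof.
move=> mf.
suff H : g_sigma_preimage (fun i (t : T) => f t 0 i) `<=` measurable.
  move=> _ A mA; rewrite setTI; apply: H.
  pose coors := fun (i : 'I_n) (x : 'rV[R]_n) => x 0 i.
  have := g_sigma_preimage_comp coors f.
  by move=> ->; exists A => //; rewrite setTI.
apply: smallest_sub; first exact: sigma_algebra_measurable.
case: n f mf => [|n] f mf; first by rewrite big_ord0.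
rewrite -bigcup_mkord_ord; apply: bigcup_sub => i Ii.
by move=> A [B mB <-]; exact: mf.
Qed.

Definition cons_row (R : realType) (n : nat)
    (p : (measurableTypeR R * 'rV[R]_n)%type) : 'rV[R]_n.+1 :=
  row_mx (p.1%:M : 'M[R]_1) p.2.

Lemma measurable_cons_row (R : realType) (n : nat) :
  measurable_fun setT (@cons_row R n).
Proof.
suff H (i : 'I_(1 + n)) : measurable_fun setT
    (fun p : measurableTypeR R * 'rV[R]_n =>
       row_mx (p.1%:M : 'M[R]_1) p.2 0 i : R).
  by apply: measurable_fun_rowP => i; exact: H.
case: (splitP i) => [j ij|k ik].
- have -> : i = lshift n j by exact/val_inj.
  rewrite ord1; under eq_fun do rewrite row_mxEl mxE eqxx mulr1n.
  exact: measurable_fst.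
- have -> : i = rshift 1 k by exact/val_inj.
  under eq_fun do rewrite row_mxEr.
  apply: (measurableT_comp (measurable_coord k)).
  exact: measurable_snd.
Qed.

HB.instance Definition _ (R : realType) (n : nat) :=
  isMeasurableFun.Build _ _ _ _ (@cons_row R n) (@measurable_cons_row R n).

(** The standard Gaussian law on [R^n]: independent [N(0, 1)] coordinates. *)
Fixpoint std_gauss (R : realType) (n : nat) : probability 'rV[R]_n R :=
  match n with
  | 0 => \d_(0 : 'rV[R]_0)
  | n'.+1 =>
      distribution (normal_prob (0 : R) 1 \x std_gauss R n')%E
        (@cons_row R n')
  end.

(** The Gaussian model [Y = f + sigma * eps]. *)

Definition gauss_obs (R : realType) (n : nat) (f : 'rV[R]_n) (sigma : R)
    (eps : 'rV[R]_n) : 'rV[R]_n :=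
  f + sigma *: eps.

Lemma measurable_gauss_obs (R : realType) (n : nat) (f : 'rV[R]_n)
    (sigma : R) :
  measurable_fun setT (gauss_obs f sigma).
Proof.
apply: measurable_fun_rowP => i; rewrite /gauss_obs.
under eq_fun do rewrite !mxE.
apply: measurable_funD => //; apply: measurable_funM => //.
exact: measurable_coord.
Qed.

HB.instance Definition _ (R : realType) (n : nat) (f : 'rV[R]_n) (sigma : R) :=
  isMeasurableFun.Build _ _ _ _ (gauss_obs f sigma)
    (measurable_gauss_obs f sigma).

Definition gauss_law (R : realType) (n : nat) (f : 'rV[R]_n) (sigma : R) :
    probability 'rV[R]_n R :=
  distribution (std_gauss R n) (gauss_obs f sigma).

(** Noncentral chi-square laws. By rotation invariance of the standard Gaussian
    law, the law of [|mu + xi|^2] depends on [mu] only through [|mu|^2]; the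
    representative chosen is [mu = (sqrt z, 0, ..., 0)]. *)

Definition noncentral_mean (R : realType) (z : R) (d : nat) : 'rV[R]_d :=
  \row_(i < d) (if val i == 0%N then Num.sqrt z else 0).

Definition sqnorm_shift (R : realType) (d : nat) (mu xi : 'rV[R]_d) : R :=
  enorm (mu + xi) ^+ 2.

Lemma measurable_sqnorm_shift (R : realType) (d : nat) (mu : 'rV[R]_d) :
  measurable_fun setT (sqnorm_shift mu).
Proof.
rewrite /sqnorm_shift /enorm.
have dot_ge0 (x : 'rV[R]_d) : 0 <= dotv x x.
  by apply: sumr_ge0 => i _; rewrite -expr2 sqr_ge0.
under eq_fun do rewrite sqr_sqrtr//.
rewrite /dotv; apply: measurable_sum => i.
under eq_fun do rewrite !mxE.
by apply: measurable_funM; apply: measurable_funD => //;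
  exact: measurable_coord.
Qed.

HB.instance Definition _ (R : realType) (d : nat) (mu : 'rV[R]_d) :=
  isMeasurableFun.Build _ _ _ _ (sqnorm_shift mu) (measurable_sqnorm_shift mu).

Definition nchi2 (R : realType) (z : R) (d : nat) : probability R R :=
  distribution (std_gauss R d) (sqnorm_shift (noncentral_mean z d)).

(* The argument is an extended real because it is built from quantiles. *)
Definition nchi2_cdf (R : realType) (z : R) (d : nat) (t : \bar R) : R :=
  fine (nchi2 z d [set x : R | (x%:E <= t)%E]).

(* The (1 - u)-quantile. For [0 < d], it is [-oo] at [u = 1] since the set is
   then the whole line. *)
Definition nchi2_quantile (R : realType) (z : R) (d : nat) (u : R) : \bar R :=
  if d is 0 then 0%E
  else ereal_inf [set x%:E | x in [set x : R | 1 - u <= nchi2_cdf z d x%:E]].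

Arguments nchi2_cdf {R} z%_R d%_N t%_E.
Arguments nchi2_quantile {R} z%_R d%_N u%_R.

(** The construction. The family of subspaces is indexed by a finite type [M],
    in which [top] stands for the index [n]. *)

Definition noise_range (R : realType) (tau eta : R) : set R :=
  `[Num.sqrt (1 - eta) * tau, tau].

Definition codim (R : realType) (n : nat) (S : {vspace 'rV[R]_n}) : nat :=
  (n - \dim S)%N.

Definition conf_radius_sq (R : realType) (n : nat) (M : finType) (top : M)
    (S : M -> {vspace 'rV[R]_n}) (beta_ : M -> R) (alpha tau eta : R) (m : M) :
    \bar R :=
  let D : nat := \dim (S m) in
  let N := codim (S m) in
  let I := noise_range tau eta in
  let t s d := (nchi2_quantile 0 d alpha * (tau ^+ 2 / s ^+ 2)%:E)%E in
  if m == top then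
    (nchi2_quantile 0 n (beta_ m) * (tau ^+ 2)%:E)%E
  else if (0 < D)%N then
    let u z s := Num.min (beta_ m / nchi2_cdf z N (t s N)) 1 in
    ereal_sup [set
      ((z * s ^+ 2)%:E + nchi2_quantile 0 D (u z s) * (s ^+ 2)%:E)%E
      | z in [set z : R | 0 <= z] & s in I]
  else
    ereal_inf [set x%:E | x in [set x : R | 0 <= x /\
      (ereal_sup [set (nchi2_cdf (x / s ^+ 2) n (t s n))%:E | s in I]
       <= (beta_ m)%:E)%E]].

(* The squared radius is an extended real only because of the value [-oo] of
   the quantile at [1]; for the parameters of interest it is finite. *)
Definition conf_radius (R : realType) (n : nat) (M : finType) (top : M)
    (S : M -> {vspace 'rV[R]_n}) (beta_ : M -> R) (alpha tau eta : R) (m : M) :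
    R :=
  Num.sqrt (fine (conf_radius_sq top S beta_ alpha tau eta m)).

Definition accepted (R : realType) (n : nat) (M : finType)
    (S : M -> {vspace 'rV[R]_n}) (alpha tau : R) (y : 'rV[R]_n) : set M :=
  [set m | ((enorm (y - orthoproj (S m) y) ^+ 2)%:E
            <= nchi2_quantile 0 (codim (S m)) alpha * (tau ^+ 2)%:E)%E].

(* [mhat] realizes some (measurable) resolution of the ties in the argmin. *)
Definition selection (R : realType) (n : nat) (M : finType) (top : M)
    (S : M -> {vspace 'rV[R]_n}) (beta_ : M -> R) (alpha tau eta : R)
    (mhat : 'rV[R]_n -> M) : Prop :=
  [/\ forall m, measurable (mhat @^-1` [set m]),
      forall y, accepted S alpha tau y (mhat y) &
      forall y m, accepted S alpha tau y m ->
        conf_radius top S beta_ alpha tau eta (mhat y)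
          <= conf_radius top S beta_ alpha tau eta m].

Definition fhat (R : realType) (n : nat) (M : finType)
    (S : M -> {vspace 'rV[R]_n}) (mhat : 'rV[R]_n -> M) (y : 'rV[R]_n) :
    'rV[R]_n :=
  orthoproj (S (mhat y)) y.

Definition rhohat (R : realType) (n : nat) (M : finType) (top : M)
    (S : M -> {vspace 'rV[R]_n}) (beta_ : M -> R) (alpha tau eta : R)
    (mhat : 'rV[R]_n -> M) (y : 'rV[R]_n) : R :=
  conf_radius top S beta_ alpha tau eta (mhat y).

(* Main.v *)
(** Rotation invariance of the standard Gaussian law reduces to the plane, where a
    rotation is a product of three shears. Rotating an orthonormal basis of [S]
    onto the first axes shows that [|Pi_S eps|^2] is central chi-square with
    [dim S] degrees of freedom, independent of the residual
    [|w + eps - Pi_S eps|^2], which is noncentral chi-square with [n - dim S]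
    degrees of freedom and noncentrality [|w|^2] when [w] is orthogonal to [S].

    If [f] is not covered, then for [m] the selected index, [m] is accepted and
    [rho_m < |f - Pi_m Y|]. For each fixed [m] this event has probability at most
    [beta_m]: acceptance has probability [p = chi2_{z,N_m}(...)] with
    [z = |f - Pi_m f|^2 / sigma^2]; either [p <= beta_m], or the excess has
    conditional probability at most [beta_m / p] by the choice of [rho_m]. A union
    bound concludes. If [f] is in [S_m], then [m] is accepted with probability at
    least [1 - alpha], and then [rhohat <= rho_m] by minimality. *)

From HB Require Import structures.
Require Import Defs.
From mathcomp Require Import all_boot all_order all_algebra.
From mathcomp Require Import all_classical all_reals all_analysis.
From mathcomp Require Import measurable_realfun.
From mathcomp Require Import ring lra.

Set Implicit Arguments.
Unset Strict Implicit.

Import Order.TTheory GRing.Theory Num.Theory.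
Import numFieldNormedType.Exports.
Local Open Scope classical_set_scope.
Local Open Scope ring_scope.

(** * Integration against a measure with a density *)

Section density.
Local Open Scope ereal_scope.
Context d (T : measurableType d) (R : realType).
Variables (mu nu : {measure set T -> \bar R}) (g : T -> R).
Hypothesis mg : measurable_fun [set: T] g.
Hypothesis g0 : forall x, (0 <= g x)%R.
Hypothesis nuE : forall A, measurable A -> nu A = \int[mu]_(x in A) (g x)%:E.

Import HBNNSimple.

Let integral_density_nnsfun (f : {nnsfun T >-> R}) :
  \int[nu]_x (f x)%:E = \int[mu]_x ((f x)%:E * (g x)%:E).
Proof.
under [LHS]eq_integral do rewrite fimfunE -fsumEFin//.
rewrite [LHS]ge0_integral_fsum//; last 2 first.
  - by move=> r; exact/measurable_EFinP/measurableT_comp.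
  - by move=> r x _; rewrite EFinM nnfun_muleindic_ge0.
under [RHS]eq_integral.
  move=> x _; rewrite fimfunE -fsumEFin// ge0_mule_fsuml; last first.
    by move=> r; rewrite EFinM nnfun_muleindic_ge0.
  over.
have mfr r : measurable_fun setT
    (fun x => (r * \1_(f @^-1` [set r]) x)%:E : \bar R).
  by apply/measurable_EFinP; apply: measurable_funM.
rewrite [RHS]ge0_integral_fsum//; last 2 first.
  - move=> r; apply: emeasurable_funM => //.
    exact/measurable_EFinP.
  - move=> r x _; apply: mule_ge0; last by rewrite lee_fin.
    by rewrite EFinM nnfun_muleindic_ge0.
apply: eq_fsbigr => r _; rewrite integralZl_indic_nnsfun//=.
rewrite integral_indic// setIT nuE// integral_mkcond.
(* Pulling [r] out of the integral needs [0 <= r]; for negative [r] the level set is empty and both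
   sides vanish. *)
have [r0|r0] := ltP r 0%R.
  rewrite preimage_nnfun0//.
  under [RHS]eq_integral do rewrite indic0 mulr0 mul0e.
  rewrite integral0 integral0_eq ?mule0// => x _.
  by rewrite patchE in_set0.
rewrite -ge0_integralZl//; last 2 first.
- apply/(measurable_restrictT _ _).1 => //; apply: measurable_funTS.
  exact/measurable_EFinP.
- by move=> x _; rewrite patchE; case: ifP => // _; rewrite lee_fin.
- by apply: eq_integral => x _; rewrite patchE indicE; case: ifP => _;
    rewrite ?mulr1 ?mulr0 ?mule0 ?mul0e.
Qed.

(** The identity for indicators is [nuE]; it passes to simple functions by linearity and to [f] by
    monotone convergence on both sides. *)
Lemma ge0_integral_density (f : T -> \bar R) :
  measurable_fun [set: T] f -> (forall x, 0 <= f x) ->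
  \int[nu]_x f x = \int[mu]_x (f x * (g x)%:E).
Proof.
move=> mf f0; pose f_ := nnsfun_approx measurableT mf.
have f_cvg x : (f_ n x)%:E @[n --> \oo] --> f x.
  by apply: cvg_nnsfun_approx => // y _; exact: f0.
have f_nd x (n m : nat) : (n <= m)%N -> (f_ n x <= f_ m x)%R.
  by move=> nm; exact/lefP/nd_nnsfun_approx.
transitivity (lim (\int[nu]_x (f_ n x)%:E @[n --> \oo])).
  rewrite -monotone_convergence//=.
  - by apply: eq_integral => x _; apply/esym/cvg_lim => //; exact: f_cvg.
  - by move=> n; exact/measurable_EFinP.
  - by move=> n x _; rewrite lee_fin.
  - by move=> x _ n m nm; rewrite lee_fin; exact: f_nd.
transitivity (lim (\int[mu]_x ((f_ n x)%:E * (g x)%:E) @[n --> \oo])).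
  by apply: congr_lim; apply/funext => n; exact: integral_density_nnsfun.
rewrite -monotone_convergence//=.
- apply: eq_integral => x _; apply/cvg_lim => //.
  by apply: cvgeMr => //; exact: f_cvg.
- by move=> n; apply: emeasurable_funM; exact/measurable_EFinP.
- by move=> n x _; rewrite mule_ge0// lee_fin.
- by move=> x _ n m nm; apply: lee_wpmul2r; rewrite lee_fin//; exact: f_nd.
Qed.

End density.

(** * Lebesgue integrals under translation and reflection *)

Section lebesgue_invariance.
Local Open Scope ereal_scope.
Context {R : realType}.
Local Notation mu := (@lebesgue_measure R).

Let measurable_shift (c : R) :
  measurable_fun [set: measurableTypeR R]
    (fun x => (x + c)%R : measurableTypeR R).
Proof. exact: measurable_funD. Qed.

Lemma lebesgue_measureD (c : R) (A : set R) : measurable A ->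
  pushforward mu ((fun x => x + c)%R : _ -> measurableTypeR R) A = mu A.
Proof.
move=> mA; apply/esym.
pose m : {measure set (measurableTypeR R) -> \bar R} :=
  pushforward mu (fun x : measurableTypeR R => (x + c)%R : measurableTypeR R).
have mE : forall X, ocitv X -> mu X = m (measurable_shift c) X; last first.
  exact: (lebesgue_measure_unique mE mA).
move=> _ [[a b]] _ <-.
rewrite /m/= /pushforward/= (_ : _ @^-1` _ = `](a - c)%R, (b - c)%R]%classic).
  rewrite !lebesgue_measure_itv/= !lte_fin ltrD2r; case: ifP => // _.
  by rewrite -!EFinD; congr EFin; lra.
by apply/seteqP; split => x /=; rewrite !in_itv/= ltrBlDr lerBrDr.
Qed.

Lemma ge0_integral_shift (c : R) (f : measurableTypeR R -> \bar R) :
  measurable_fun [set: measurableTypeR R] f -> (forall x, 0 <= f x) ->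
  \int[mu]_x f (x + c)%R = \int[mu]_x f x.
Proof.
move=> mf f0.
transitivity (\int[pushforward mu
    ((fun x => x + c)%R : _ -> measurableTypeR R)]_x f x).
  by rewrite ge0_integral_pushforward.
by apply: eq_measure_integral => //= A mA _; exact: lebesgue_measureD.
Qed.

Lemma ge0_integral_opp (f : measurableTypeR R -> \bar R) :
  measurable_fun [set: measurableTypeR R] f -> (forall x, 0 <= f x) ->
  \int[mu]_x f (- x)%R = \int[mu]_x f x.
Proof.
move=> mf f0.
transitivity (\int[pushforward mu (-%R : _ -> measurableTypeR R)]_x f x).
  by rewrite ge0_integral_pushforward.
by apply: eq_measure_integral => //= A mA _; exact: lebesgue_measureN.
Qed.

End lebesgue_invariance.

(** * Rotation invariance of the planar normal law *)

Section normal_integral.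
Local Open Scope ereal_scope.
Context {R : realType}.
Local Notation mu := (@lebesgue_measure R).
Local Notation RR := (measurableTypeR R).
Local Notation N := (normal_prob (0 : R) 1).
Local Notation phi := (normal_pdf (0 : R) 1).

Lemma ge0_integral_normal (f : RR -> \bar R) :
  measurable_fun [set: RR] f -> (forall x, 0 <= f x) ->
  \int[N]_x f x = \int[mu]_x (f x * (phi x)%:E).
Proof.
move=> mf f0; apply: ge0_integral_density => //.
- exact: measurable_normal_pdf.
- by move=> x; exact: normal_pdf_ge0.
Qed.

Lemma normal_pdf01E (x : R) : phi x = (normal_peak 1 * expR (- x ^+ 2 / 2))%R.
Proof.
by rewrite normal_pdfE ?oner_neq0// /normal_fun subr0 expr1n.
Qed.

Lemma normal_pdfN (x : R) : phi (- x)%R = phi x.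
Proof. by rewrite !normal_pdf01E sqrrN. Qed.

Lemma ge0_integral_normal_opp (f : RR -> \bar R) :
  measurable_fun [set: RR] f -> (forall x, 0 <= f x) ->
  \int[N]_x f (- x)%R = \int[N]_x f x.
Proof.
move=> mf f0.
have mphi : measurable_fun [set: RR] (EFin \o phi).
  by apply/measurable_EFinP; exact: measurable_normal_pdf.
rewrite !ge0_integral_normal//; last first.
  by apply: measurableT_comp => //; exact: measurable_oppr.
rewrite -[RHS]ge0_integral_opp.
- by apply: eq_integral => x _; rewrite normal_pdfN.
- exact: emeasurable_funM.
- by move=> x; rewrite mule_ge0// lee_fin normal_pdf_ge0.
Qed.

Definition plane_shearl (a : R) (p : RR * RR) : RR * RR :=
  (p.1 + a * p.2, p.2)%R.
Definition plane_shearr (a : R) (p : RR * RR) : RR * RR :=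
  (p.1, p.2 + a * p.1)%R.
Definition plane_rot (c s : R) (p : RR * RR) : RR * RR :=
  (c * p.1 - s * p.2, s * p.1 + c * p.2)%R.

Lemma measurable_plane_shearl a : measurable_fun setT (plane_shearl a).
Proof.
apply/measurable_fun_pairP; split; last exact: measurable_snd.
apply: measurable_funD; first exact: measurable_fst.
by apply: measurable_funM => //; exact: measurable_snd.
Qed.

Lemma measurable_plane_shearr a : measurable_fun setT (plane_shearr a).
Proof.
apply/measurable_fun_pairP; split; first exact: measurable_fst.
apply: measurable_funD; first exact: measurable_snd.
by apply: measurable_funM => //; exact: measurable_fst.
Qed.

Lemma measurable_plane_rot c s : measurable_fun setT (plane_rot c s).
Proof.
apply/measurable_fun_pairP; split.
- by apply: measurable_funB; apply: measurable_funM.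
- by apply: measurable_funD; apply: measurable_funM.
Qed.

Lemma integral_plane_shearr a (h : RR * RR -> \bar R) :
  measurable_fun setT h -> (forall p, 0 <= h p) ->
  \int[mu \x mu]_p h (plane_shearr a p) = \int[mu \x mu]_p h p.
Proof.
move=> mh h0; rewrite !fubini_tonelli1//; last first.
  by apply: measurableT_comp => //; exact: measurable_plane_shearr.
apply: eq_integral => x _; rewrite /fubini_F.
by apply: (@ge0_integral_shift R (a * x) (fun y => h (x, y))) => //;
  exact: measurableT_comp.
Qed.

Lemma integral_plane_shearl a (h : RR * RR -> \bar R) :
  measurable_fun setT h -> (forall p, 0 <= h p) ->
  \int[mu \x mu]_p h (plane_shearl a p) = \int[mu \x mu]_p h p.
Proof.
move=> mh h0; rewrite !fubini_tonelli2//; last first.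
  by apply: measurableT_comp => //; exact: measurable_plane_shearl.
apply: eq_integral => y _; rewrite /fubini_G.
by apply: (@ge0_integral_shift R (a * y) (fun x => h (x, y))) => //;
  exact: measurableT_comp.
Qed.

(** If [c] and [s] are the cosine and sine of an angle, [t] is the tangent of half that angle. *)
Lemma plane_rot_shear c s : (c ^+ 2 + s ^+ 2 = 1)%R -> s != 0%R ->
  let t := ((1 - c) / s)%R in
  plane_rot c s = plane_shearl (- t) \o plane_shearr s \o plane_shearl (- t).
Proof.
move=> cs s0 t; apply/funext => -[x y].
rewrite /plane_rot /plane_shearl /plane_shearr /=.
have c2 : (c ^+ 2 = 1 - s ^+ 2)%R by rewrite -cs addrK.
by congr (_, _)%R; rewrite /t; field: c2.
Qed.

(** The joint density depends on the point only through [p.1 ^+ 2 + p.2 ^+ 2], so rotation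
    invariance is left to be checked for Lebesgue measure. *)
Lemma integral_normal2E (h : RR * RR -> \bar R) :
  measurable_fun setT h -> (forall p, 0 <= h p) ->
  \int[N]_x \int[N]_y h (x, y) =
  \int[mu \x mu]_p (h p *
    (normal_peak 1 ^+ 2 * expR (- (p.1 ^+ 2 + p.2 ^+ 2) / 2))%:E).
Proof.
move=> mh h0.
have mphi : measurable_fun [set: RR] (EFin \o phi).
  by apply/measurable_EFinP; exact: measurable_normal_pdf.
have hxm x : measurable_fun [set: RR] (fun y => h (x, y)).
  exact: measurableT_comp.
rewrite ge0_integral_normal; last 2 first.
- exact: (@measurable_fun_fubini_tonelli_F _ _ _ _ _ N h).
- by move=> x; exact: integral_ge0.
rewrite fubini_tonelli1; last 2 first.
- apply: emeasurable_funM => //; apply/measurable_EFinP.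
  apply: measurable_funM => //; apply: measurableT_comp => //.
  apply: measurable_funM => //; apply: measurableT_comp => //.
  by apply: measurable_funD; apply: measurable_funX;
    [exact: measurable_fst|exact: measurable_snd].
- by move=> p; rewrite mule_ge0// lee_fin mulr_ge0 ?expR_ge0 ?sqr_ge0.
apply: eq_integral => x _; rewrite /fubini_F (ge0_integral_normal (hxm x))//.
rewrite -ge0_integralZr//; last 3 first.
- exact: emeasurable_funM.
- by move=> y _; rewrite mule_ge0// lee_fin normal_pdf_ge0.
- by rewrite lee_fin normal_pdf_ge0.
apply: eq_integral => y _; rewrite -muleA -EFinM; congr (_ * _%:E).
rewrite !normal_pdf01E /= mulrACA -expRD expr2; congr (_ * expR _)%R.
by field.
Qed.

(* Shears preserve Lebesgue measure by Tonelli and translation invariance. *)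
Lemma integral_normal_plane_rot c s (h : RR * RR -> \bar R) :
  (c ^+ 2 + s ^+ 2 = 1)%R ->
  measurable_fun setT h -> (forall p, 0 <= h p) ->
  \int[N]_x \int[N]_y h (plane_rot c s (x, y)) = \int[N]_x \int[N]_y h (x, y).
Proof.
move=> cs mh h0.
(* The shears require [s != 0]. For [s = 0] the map is the identity or [p |-> - p], and the latter
   is absorbed by evenness of the normal density in each coordinate. *)
have [s0|s0] := eqVneq s 0%R.
  have : (c == 1)%R || (c == -1)%R by rewrite -sqrf_eq1 -cs s0 expr0n addr0.
  have hxm x : measurable_fun [set: RR] (fun y => h (x, y)).
    exact: measurableT_comp.
  case/orP => /eqP c1; rewrite s0 c1 /plane_rot /=.
    by apply: eq_integral => x _; apply: eq_integral => y _;
      rewrite !mul0r !mul1r subr0 add0r.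
  rewrite -[RHS]ge0_integral_normal_opp; last 2 first.
  - exact: (@measurable_fun_fubini_tonelli_F _ _ _ _ _ N h).
  - by move=> x; exact: integral_ge0.
  apply: eq_integral => x _.
  rewrite -[RHS]ge0_integral_normal_opp//.
  by apply: eq_integral => y _; rewrite !mul0r !mulN1r subr0 add0r.
have mhr : measurable_fun setT (h \o plane_rot c s).
  by apply: measurableT_comp => //; exact: measurable_plane_rot.
rewrite (integral_normal2E mh h0).
rewrite (integral_normal2E mhr (fun p => h0 (plane_rot c s p))).
pose G (p : RR * RR) := h p *
  (normal_peak 1 ^+ 2 * expR (- (p.1 ^+ 2 + p.2 ^+ 2) / 2))%:E.
have mG : measurable_fun setT G.
  apply: emeasurable_funM => //; apply/measurable_EFinP.
  apply: measurable_funM => //; apply: measurableT_comp => //.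
  apply: measurable_funM => //; apply: measurableT_comp => //.
  by apply: measurable_funD; apply: measurable_funX;
    [exact: measurable_fst|exact: measurable_snd].
have G0 p : 0 <= G p.
  by rewrite mule_ge0// lee_fin mulr_ge0 ?expR_ge0 ?sqr_ge0.
transitivity (\int[mu \x mu]_p G (plane_rot c s p)).
  apply: eq_integral => -[x y] _; rewrite /G/=; congr (_ * (_ * expR _)%:E).
  congr (- _ / _)%R.
  rewrite -[LHS]mul1r -cs; ring.
rewrite (plane_rot_shear cs s0); set t := (_ / s)%R.
have mG1 := measurableT_comp mG (measurable_plane_shearl (- t)).
have mG2 := measurableT_comp mG1 (measurable_plane_shearr s).
apply: (etrans (integral_plane_shearl (- t) mG2 (fun p => G0 _))).
apply: (etrans (integral_plane_shearr s mG1 (fun p => G0 _))).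
exact: (integral_plane_shearl (- t) mG G0).
Qed.

End normal_integral.

(** * Euclidean algebra of row vectors, one coordinate at a time *)

Section rows.
Context {R : realType}.
Implicit Types n : nat.

Lemma dotv_cons n (a b : R) (v w : 'rV[R]_n) :
  dotv (cons_row (a, v)) (cons_row (b, w)) = a * b + dotv v w.
Proof.
rewrite !dotvE /cons_row /= (@tr_row_mx _ 1 1 n) (@mul_row_col _ 1 1 n 1).
rewrite mxE tr_scalar_mx.
by rewrite -scalar_mxM mxE eqxx mulr1n.
Qed.

Lemma dotvv_ge0 n (v : 'rV[R]_n) : 0 <= dotv v v.
Proof. by apply: sumr_ge0 => i _; rewrite -expr2 sqr_ge0. Qed.

Lemma sqr_enorm n (v : 'rV[R]_n) : enorm v ^+ 2 = dotv v v.
Proof. by rewrite sqr_sqrtr ?dotvv_ge0. Qed.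

Lemma enorm_ge0 n (v : 'rV[R]_n) : 0 <= enorm v.
Proof. exact: sqrtr_ge0. Qed.

Lemma dotvC n (v w : 'rV[R]_n) : dotv v w = dotv w v.
Proof. by apply: eq_bigr => i _; rewrite mulrC. Qed.

Lemma dotvDl n (u v w : 'rV[R]_n) : dotv (u + v) w = dotv u w + dotv v w.
Proof. by rewrite !dotvE mulmxDl mxE. Qed.

Lemma dotvZl n (a : R) (v w : 'rV[R]_n) : dotv (a *: v) w = a * dotv v w.
Proof. by rewrite !dotvE -scalemxAl mxE. Qed.

Lemma dotvDr n (u v w : 'rV[R]_n) : dotv w (u + v) = dotv w u + dotv w v.
Proof. by rewrite !(dotvC w) dotvDl. Qed.

Lemma dotvZr n (a : R) (v w : 'rV[R]_n) : dotv v (a *: w) = a * dotv v w.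
Proof. by rewrite !(dotvC v) dotvZl. Qed.

Lemma dotv0 n (v : 'rV[R]_n) : dotv v 0 = 0.
Proof. by rewrite dotvE trmx0 mulmx0 mxE. Qed.

Lemma cons_rowP n (v : 'rV[R]_n.+1) : exists (a : R) w, v = cons_row (a, w).
Proof.
exists (v 0 0), (@rsubmx _ 1 1 n v).
rewrite /cons_row /= (_ : (v 0 0)%:M = @lsubmx _ 1 1 n v) ?hsubmxK//.
rewrite [RHS]mx11_scalar mxE; congr (v _ _)%:M.
exact/val_inj.
Qed.

Lemma cons_rowD n (a b : R) (v w : 'rV[R]_n) :
  cons_row (a, v) + cons_row (b, w) = cons_row (a + b, v + w).
Proof. by rewrite /cons_row /= (@add_row_mx _ 1 1 n) -raddfD. Qed.

Lemma mul_cons_row_block n m (a : R) (v : 'rV[R]_n) (d : R) (u : 'rV[R]_m)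
    (l : 'cV[R]_n) (A : 'M[R]_(n, m)) :
  cons_row (a, v) *m block_mx d%:M u l A =
  cons_row (a * d + dotv v l^T, a *: u + v *m A).
Proof.
rewrite /cons_row /= (@mul_row_block _ 1 1 n 1 m) -scalar_mxM mul_scalar_mx; congr row_mx.
by rewrite raddfD/= dotvE trmxK -mx11_scalar.
Qed.

Lemma orthogonal_mxP n (A : 'M[R]_n) :
  (forall v w : 'rV[R]_n, dotv (v *m A) (w *m A) = dotv v w) -> A *m A^T = 1%:M.
Proof.
move=> AE; apply/matrixP => i j.
have := AE (row i 1%:M) (row j 1%:M).
rewrite -!row_mul !mul1mx /dotv => AAij; rewrite mxE.
under eq_bigr do rewrite [A^T _ _]mxE.
transitivity (\sum_k row i A 0 k * row j A 0 k).
  by apply: eq_bigr => k _; rewrite !mxE.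
rewrite AAij (bigD1 i)//= !mxE eqxx mul1r big1 ?addr0 1?eq_sym// => k ki.
by rewrite !mxE eq_sym (negbTE ki) mul0r.
Qed.

Lemma dotv_mul_orthogonal n (A : 'M[R]_n) (v w : 'rV[R]_n) :
  A *m A^T = 1%:M -> dotv (v *m A) (w *m A) = dotv v w.
Proof. by move=> AA; rewrite !dotvE trmx_mul mulmxA -(mulmxA v) AA mulmx1. Qed.

Lemma measurable_mulmxr n m (A : 'M[R]_(n, m)) :
  measurable_fun setT (fun v : 'rV[R]_n => v *m A).
Proof.
apply: measurable_fun_rowP => i; under eq_fun do rewrite mxE.
apply: measurable_sum => j; apply: measurable_funM => //.
exact: measurable_coord.
Qed.

Lemma measurable_preimage d d' (T : measurableType d) (U : measurableType d')
    (f : T -> U) (E : set U) :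
  measurable_fun setT f -> measurable E -> measurable (f @^-1` E).
Proof. by move=> mf mE; rewrite -[X in measurable X]setTI; exact: mf. Qed.

End rows.

(** * Matrices that preserve the standard Gaussian law *)

Section gaussian_orthogonal.
Context {R : realType}.
Implicit Types n : nat.
Local Notation N := (normal_prob (0 : R) 1).

Lemma std_gaussS n (E : set 'rV[R]_n.+1) :
  std_gauss R n.+1 E =
  (\int[N]_x std_gauss R n [set v | E (cons_row (x, v))])%E.
Proof.
rewrite /= /distribution /pushforward /= /product_measure1.
by apply: eq_integral => x _ /=; rewrite xsectionE.
Qed.

Lemma measurable_cons_row_slice n (E : set 'rV[R]_n.+1) (x : R) :
  measurable E -> measurable [set v : 'rV[R]_n | E (cons_row (x, v))].
Proof.
move=> mE; rewrite -[X in measurable X](xsectionE (@cons_row R n @^-1` E) x).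
apply: measurable_xsection; apply: measurable_preimage => //.
Qed.

Lemma measurable_std_gauss_slice n (E : set 'rV[R]_n.+1) : measurable E ->
  measurable_fun [set: measurableTypeR R]
    (fun x => std_gauss R n [set v | E (cons_row (x, v))]).
Proof.
move=> mE; under eq_fun do rewrite
  -[X in std_gauss R n X]/((fun y => (_, y)) @^-1` (@cons_row R n @^-1` E))
  -xsectionE.
by apply: measurable_fun_xsection; exact: measurable_preimage.
Qed.

(** Orthogonality and invariance travel together: matrices with both are closed under product, and
    the generators below suffice to move any row onto the first axis. *)
Definition gauss_orthogonal n (A : 'M[R]_n) : Prop :=
  A *m A^T = 1%:M /\ forall E, measurable E ->
    std_gauss R n [set v | E (v *m A)] = std_gauss R n E.

Lemma gauss_orthogonal1 n : gauss_orthogonal (1%:M : 'M[R]_n).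
Proof.
split=> [|E mE]; first by rewrite trmx1 mulmx1.
by congr (std_gauss R n _); apply/seteqP; split => v /=; rewrite mulmx1.
Qed.

Lemma gauss_orthogonalM n (A B : 'M[R]_n) :
  gauss_orthogonal A -> gauss_orthogonal B -> gauss_orthogonal (A *m B).
Proof.
move=> [AA Ai] [BB Bi]; split=> [|E mE].
  by rewrite trmx_mul mulmxA -(mulmxA A) BB mulmx1.
rewrite -[RHS]Bi// -[RHS]Ai//; last first.
  exact: (measurable_preimage (measurable_mulmxr B) mE).
by congr (std_gauss R n _); apply/seteqP; split => v /=; rewrite mulmxA.
Qed.

Lemma gauss_orthogonal_block n (A : 'M[R]_n) :
  gauss_orthogonal A ->
  gauss_orthogonal (block_mx 1%:M 0 0 A : 'M[R]_(1 + n)).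
Proof.
move=> [AA Ai]; split=> [|E mE].
  rewrite (@tr_block_mx _ 1 n 1 n) (@mulmx_block _ 1 n 1 n 1 n).
  rewrite !trmx0 !mulmx0 !mul0mx !addr0 !add0r AA.
  by rewrite trmx1 mulmx1 -scalar_mx_block.
rewrite !(@std_gaussS n); apply: eq_integral => x _.
rewrite -[RHS]Ai; last exact: measurable_cons_row_slice.
congr (std_gauss R n _); apply/seteqP; split => v /=;
  by rewrite mul_cons_row_block trmx0 dotv0 mulr1 scaler0 addr0 add0r.
Qed.

(** Evenness of the normal density. In dimension one, a sign change is what brings a negative
    coordinate to its norm. *)
Lemma gauss_orthogonal_flip n :
  gauss_orthogonal (block_mx (-1)%:M 0 0 1%:M : 'M[R]_(1 + n)).
Proof.
split=> [|E mE].
  rewrite (@tr_block_mx _ 1 n 1 n) (@mulmx_block _ 1 n 1 n 1 n).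
  rewrite !trmx0 !mulmx0 !mul0mx !addr0 !add0r.
  by rewrite trmx1 mulmx1 tr_scalar_mx -scalar_mxM mulrNN mulr1 -scalar_mx_block.
rewrite !(@std_gaussS n) -[RHS]ge0_integral_normal_opp//.
  apply: eq_integral => x _; congr (std_gauss R n _).
  by apply/seteqP; split => v /=;
    rewrite mul_cons_row_block trmx0 dotv0 mulrN1 scaler0 addr0 add0r mulmx1.
exact: measurable_std_gauss_slice.
Qed.

(** Vectors are rows acted on from the right, so this is the transpose of the usual matrix of
    [plane_rot], extended by the identity. *)
Definition rot_block n (c s : R) : 'M[R]_(1 + (1 + n)) :=
  block_mx c%:M (row_mx s%:M 0) (col_mx (- s)%:M 0) (block_mx c%:M 0 0 1%:M).

Lemma mul_rot_block n (c s x y : R) (v : 'rV[R]_n) :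
  cons_row (x, cons_row (y, v)) *m rot_block n c s =
  cons_row (c * x - s * y, cons_row (s * x + c * y, v)).
Proof.
rewrite mul_cons_row_block mul_cons_row_block.
rewrite (@tr_col_mx _ 1 n 1) tr_scalar_mx trmx0.
rewrite -[@row_mx _ 1 1 n (- s)%:M 0]/(cons_row (- s, 0)) dotv_cons dotv0 addr0.
rewrite addr0 scaler0 add0r mulmx1 (@scale_row_mx _ 1 1 n) scaler0.
rewrite scale_scalar_mx -[@row_mx _ 1 1 n _ 0]/(cons_row (x * s, 0)) cons_rowD add0r.
by congr (cons_row (_, cons_row (_, _))); ring.
Qed.

Lemma gauss_orthogonal_rot n (c s : R) : c ^+ 2 + s ^+ 2 = 1 ->
  gauss_orthogonal (rot_block n c s).
Proof.
move=> cs; split=> [|E mE].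
  apply: orthogonal_mxP => v w.
  have [x [v1 ->]] := cons_rowP v; have [y [v2 ->]] := cons_rowP v1.
  have [x' [w1 ->]] := cons_rowP w; have [y' [w2 ->]] := cons_rowP w1.
  rewrite !mul_rot_block !dotv_cons !addrA; congr (_ + _).
  transitivity ((c ^+ 2 + s ^+ 2) * (x * x' + y * y')); first by ring.
  by rewrite cs mul1r.
pose h (p : measurableTypeR R * measurableTypeR R) :=
  std_gauss R n [set v | E (cons_row (p.1, cons_row (p.2, v)))].
have gE (F : set 'rV[R]_(n.+2)) : std_gauss R n.+2 F =
   (\int[N]_x \int[N]_y
      std_gauss R n [set v | F (cons_row (x, cons_row (y, v)))])%E.
  by rewrite std_gaussS; apply: eq_integral => x _; rewrite std_gaussS.
rewrite !gE; transitivity (\int[N]_x \int[N]_y h (plane_rot c s (x, y)))%E.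
  apply: eq_integral => x _; apply: eq_integral => y _.
  congr (std_gauss R n _); apply/seteqP; split => v /=;
    by rewrite mul_rot_block.
apply: (integral_normal_plane_rot cs) => //.
(* [h] is the measure of the sections of the preimage of [E] under the map that prepends two
   coordinates, hence measurable. *)
pose RR := measurableTypeR R.
pose e (q : (RR * RR) * 'rV[R]_n) := cons_row (q.1.1, cons_row (q.1.2, q.2)).
have m11 : measurable_fun setT (fun q : (RR * RR) * 'rV[R]_n => q.1.1).
  exact: (measurableT_comp measurable_fst measurable_fst).
have m12 : measurable_fun setT (fun q : (RR * RR) * 'rV[R]_n => q.1.2).
  exact: (measurableT_comp measurable_snd measurable_fst).
have me : measurable_fun setT e.
  apply: (measurableT_comp (@measurable_cons_row R n.+1)).
  apply: measurable_fun_pair => //.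
  apply: (measurableT_comp (@measurable_cons_row R n)).
  exact: measurable_fun_pair.
pose F := e @^-1` E.
have mF : measurable F := measurable_preimage me mE.
have := @measurable_fun_xsection _ _ _ _ R (std_gauss R n) F mF.
by congr (measurable_fun _ _); apply/funext => p /=; rewrite xsectionE.
Qed.

(* Rotate the tail onto its first axis, then the plane of the first two axes. *)
Lemma gauss_orthogonal_transitive n (y : 'rV[R]_n.+1) :
  exists2 A, gauss_orthogonal A & y *m A = cons_row (enorm y, 0).
Proof.
elim: n y => [|n IHn] y.
  have [a [w ->]] := cons_rowP y; rewrite (thinmx0 w).
  have -> : enorm (cons_row (a, 0 : 'rV[R]_0)) = `|a|.
    by rewrite /enorm dotv_cons dotv0 addr0 -expr2 sqrtr_sqr.
  have [a0|a0] := leP 0 a.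
    exists 1%:M; first exact: gauss_orthogonal1.
    by rewrite mulmx1 ger0_norm.
  exists (block_mx (-1)%:M 0 0 1%:M : 'M[R]_(1 + 0)).
    exact: gauss_orthogonal_flip.
  rewrite mul_cons_row_block trmx0 dotv0 mulrN1 scaler0 !addr0 mul0mx.
  by rewrite ltr0_norm// addr0.
have [a [w ->]] := cons_rowP y; have [A GA wA] := IHn w.
pose B : 'M[R]_(1 + n.+1) := block_mx 1%:M 0 0 A.
have GB : gauss_orthogonal B by exact: gauss_orthogonal_block.
have yB : cons_row (a, w) *m B = cons_row (a, cons_row (enorm w, 0)).
  by rewrite mul_cons_row_block trmx0 dotv0 mulr1 scaler0 addr0 add0r wA.
have rE : enorm (cons_row (a, w)) ^+ 2 = a ^+ 2 + enorm w ^+ 2.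
  by rewrite !sqr_enorm dotv_cons expr2.
set r := enorm (cons_row (a, w)) in rE *.
(* A zero norm forces [a] and the tail to vanish, so [B] alone works; otherwise division by [r] is
   legitimate. *)
have [r0|r0] := eqVneq r 0.
  move: rE; rewrite r0 expr0n => /esym/eqP.
  rewrite paddr_eq0 ?sqr_ge0// !sqrf_eq0 => /andP[/eqP a0 /eqP w0].
  exists B => //; rewrite yB a0 w0; congr (cons_row (_, _)).
  by rewrite /cons_row /= raddf0 row_mx0.
(* Cosine [a / r] and sine [- enorm w / r] send the plane vector [(a, enorm w)] to [(r, 0)]. *)
have cs : (a / r) ^+ 2 + (- enorm w / r) ^+ 2 = 1.
  by rewrite !expr_div_n sqrrN -mulrDl -rE divff// sqrf_eq0.
exists (B *m rot_block n (a / r) (- enorm w / r)).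
  exact: (gauss_orthogonalM GB (gauss_orthogonal_rot n cs)).
rewrite mulmxA yB mul_rot_block; congr (cons_row (_, _)).
  rewrite !mulNr opprK; apply: (mulIf r0); rewrite -[RHS]expr2 rE.
  by field.
rewrite (_ : _ + _ = 0); last by rewrite !mulNr mulrAC [a / r * _]mulrAC (mulrC a) addNr.
by rewrite /cons_row /= raddf0 row_mx0.
Qed.

End gaussian_orthogonal.

(** * Independence of projection and residual norms *)

Section chi2_independence.
Context {R : realType}.
Implicit Types n : nat.

Lemma measurable_dotv_diag d (T : measurableType d) n (f : T -> 'rV[R]_n) :
  measurable_fun setT f -> measurable_fun setT (fun t => dotv (f t) (f t)).
Proof.
move=> mf; apply: measurable_sum => i.
by apply: measurable_funM;
  apply: (measurableT_comp (measurable_coord i)).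
Qed.

Lemma measurable_addv n (w : 'rV[R]_n) : measurable_fun setT (fun e => w + e).
Proof.
apply: measurable_fun_rowP => i; under eq_fun do rewrite mxE.
by apply: measurable_funD => //; exact: measurable_coord.
Qed.

Lemma noncentral_meanS n (z : R) :
  noncentral_mean z n.+1 = cons_row (Num.sqrt z, 0).
Proof.
have [a [w aw]] := cons_rowP (noncentral_mean z n.+1).
rewrite aw; congr (cons_row (_, _)).
  by have := congr1 (fun A : 'rV[R]_(1 + n) => A 0 (lshift n 0)) aw;
    rewrite /cons_row /= row_mxEl !mxE/= mulr1n => <-.
apply/rowP => j.
by have := congr1 (fun A : 'rV[R]_(1 + n) => A 0 (rshift 1 j)) aw;
  rewrite /cons_row /= row_mxEr !mxE/= => <-.
Qed.

(** Rotating [w] onto the first axis turns it into a [noncentral_mean], so the law depends on [w]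
    only through its squared norm. *)
Lemma nchi2E n (w : 'rV[R]_n) (E : set R) : measurable E ->
  nchi2 (dotv w w) n E = std_gauss R n [set e | E (dotv (w + e) (w + e))].
Proof.
move=> mE; rewrite /nchi2 /distribution /pushforward.
case: n w => [|n] w.
  congr (std_gauss R 0 _); apply/seteqP; split => e /=;
    by rewrite /sqnorm_shift sqr_enorm (thinmx0 w) (thinmx0 (noncentral_mean _ _)).
have [A [AA GA] wA] := gauss_orthogonal_transitive w.
rewrite noncentral_meanS -/(enorm w) -wA.
rewrite -[LHS]GA; last first.
  apply: (@measurable_preimage _ _ _ _ (sqnorm_shift (w *m A)) E) => //.
by congr (std_gauss R n.+1 _); apply/seteqP; split => e /=;
  rewrite /sqnorm_shift sqr_enorm -mulmxDl dotv_mul_orthogonal.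
Qed.

(** If [B] has orthonormal rows and [w *m B^T = 0], the difference is, by Pythagoras, the squared
    norm of the residual of [w + e] after projection onto the span of the rows. *)
Definition split_event n D (B : 'M[R]_(D, n)) (w : 'rV[R]_n) (t1 t2 : R) :
    set 'rV[R]_n :=
  [set e | dotv (w + e) (w + e) - dotv (e *m B^T) (e *m B^T) <= t1 /\
           t2 < dotv (e *m B^T) (e *m B^T)].

Lemma measurable_split_event n D (B : 'M[R]_(D, n)) w t1 t2 :
  measurable (split_event B w t1 t2).
Proof.
have mB : measurable_fun setT (fun e => dotv (e *m B^T) (e *m B^T)).
  exact: (measurable_dotv_diag (measurable_mulmxr B^T)).
have mw := measurable_dotv_diag (measurable_addv w).
rewrite (_ : split_event _ _ _ _ =
    (fun e => dotv (w + e) (w + e) - dotv (e *m B^T) (e *m B^T)) @^-1`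
      `]-oo, t1] `&`
    (fun e => dotv (e *m B^T) (e *m B^T)) @^-1` `]t2, +oo[).
  apply: measurableI; last exact: measurable_preimage.
  by apply: measurable_preimage => //; exact: measurable_funB.
by apply/seteqP; split => e /=; rewrite !in_itv/= andbT.
Qed.

Lemma measurable_dotv_gt n (t : R) : measurable [set e : 'rV[R]_n | t < dotv e e].
Proof.
rewrite (_ : mkset _ = (fun e : 'rV[R]_n => dotv e e) @^-1` `]t, +oo[).
  apply: measurable_preimage => //.
  exact: (@measurable_dotv_diag _ 'rV[R]_n n id (@measurable_id _ _ setT)).
by apply/seteqP; split => e /=; rewrite in_itv/= andbT.
Qed.

(* Rotating the first row of [B] onto the first axis peels off one coordinate,
   which enters only the second of the two squared norms. *)
Lemma gauss_split_event n D (B : 'M[R]_(D, n)) (w : 'rV[R]_n) (t1 t2 : R) :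
  B *m B^T = 1%:M -> w *m B^T = 0 ->
  std_gauss R n (split_event B w t1 t2) =
  (nchi2 (dotv w w) (n - D) [set x : R | (x <= t1)%R] *
   std_gauss R D [set e | (t2 < dotv e e)%R])%E.
Proof.
have mle : measurable [set x : R | x <= t1].
  rewrite (_ : mkset _ = `]-oo, t1]%classic) //.
elim: D n B w t2 => [|D IHD] n B w t2 BB wB.
  have d0 (e : 'rV[R]_0) : dotv e e = 0 by rewrite (thinmx0 e) dotv0.
  rewrite subn0 nchi2E//.
  (* Without rows the second norm is 0, so the second condition holds always or never, according to
     the sign of [t2]. *)
  have [t20|t20] := ltP t2 0.
    rewrite [X in (_ * std_gauss R 0 X)%E](_ : _ = setT); last first.
      by apply/seteqP; split => // e _ /=; rewrite d0.
    rewrite probability_setT mule1; congr (std_gauss R n _).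
    by apply/seteqP; split => e; rewrite /split_event/= d0 subr0; tauto.
  rewrite (_ : split_event _ _ _ _ = set0).
    rewrite [X in (_ * std_gauss R 0 X)%E](_ : _ = set0) ?measure0 ?mule0//.
    by apply/seteqP; split => // e /=; rewrite d0 ltNge t20.
  by apply/seteqP; split => // e []; rewrite d0 ltNge t20.
(* [n = 0] is impossible: the first row of [B] would have norm 1 in a zero space. *)
case: n B w BB wB => [|n] B w BB wB.
  have := congr1 (fun A : 'M[R]_D.+1 => A 0 0) BB.
  by rewrite !mxE big_ord0 eqxx => /eqP; rewrite eq_sym oner_eq0.
have BBij i j : dotv (row i B) (row j B) = (i == j)%:R.
  have := congr1 (fun A : 'M[R]_D.+1 => A i j) BB; rewrite !mxE => <-.
  by apply: eq_bigr => k _; rewrite !mxE.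
have wBj j : dotv w (row j B) = 0.
  have := congr1 (fun A : 'rV[R]_D.+1 => A 0 j) wB; rewrite !mxE => <-.
  by apply: eq_bigr => k _; rewrite !mxE.
have [A [AA GA]] := gauss_orthogonal_transitive (row 0 B).
rewrite /enorm BBij eqxx sqrtr1 => bA.
have [w0 [w' wA]] := cons_rowP (w *m A).
have w00 : w0 = 0.
  have := wBj 0; rewrite -(dotv_mul_orthogonal _ _ AA) bA wA dotv_cons dotv0.
  by rewrite mulr1 addr0.
rewrite {}w00 in wA.
(* After the rotation, [w] and the other rows are orthogonal to the first axis; deleting their first
   coordinate gives [w'] and [B'], which satisfy the hypotheses again. *)
pose B' : 'M[R]_(D, n) := \matrix_(i, j) (B *m A) (lift 0 i) (lift 0 j).
have rowBA i : row (lift 0 i) B *m A = cons_row (0, row i B').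
  have [a [v av]] := cons_rowP (row (lift 0 i) B *m A); rewrite av.
  have a0 : a = 0.
    have := BBij (lift 0 i) 0; rewrite -(dotv_mul_orthogonal _ _ AA) bA av.
    by rewrite dotv_cons dotv0 mulr1 addr0.
  rewrite a0; congr (cons_row (_, _)); apply/rowP => j.
  have := congr1 (fun A : 'rV[R]_(1 + n) => A 0 (rshift 1 j)) av.
  rewrite /cons_row /= row_mxEr => <-; rewrite !mxE.
  apply: eq_bigr => k _; rewrite !mxE; congr (_ * A _ _); exact/val_inj.
have mulB' v i : (v *m B'^T) 0 i = dotv v (row i B').
  by rewrite mxE; apply: eq_bigr => k _; rewrite !mxE.
have BB' : B' *m B'^T = 1%:M.
  apply/matrixP => i j.
  have := BBij (lift 0 i) (lift 0 j).
  rewrite -(dotv_mul_orthogonal _ _ AA) !rowBA dotv_cons mulr0 add0r.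
  rewrite (inj_eq lift_inj) => e; rewrite [RHS]mxE -e mxE.
  by apply: eq_bigr => k _; rewrite !mxE.
have wB' : w' *m B'^T = 0.
  apply/rowP => i; rewrite mulB' mxE -(wBj (lift 0 i)).
  by rewrite -(dotv_mul_orthogonal _ _ AA) rowBA wA dotv_cons mulr0 add0r.
have dotBA x v : dotv (cons_row (x, v) *m (B *m A)^T)
    (cons_row (x, v) *m (B *m A)^T) =
    x ^+ 2 + dotv (v *m B'^T) (v *m B'^T).
  rewrite {1}/dotv big_ord_recl.
  have mE i : (cons_row (x, v) *m (B *m A)^T) 0 i =
      dotv (cons_row (x, v)) (row i B *m A).
    by rewrite -row_mul !mxE; apply: eq_bigr => k _; rewrite !mxE.
  rewrite mE bA dotv_cons dotv0 mulr1 addr0 expr2; congr (_ + _).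
  apply: eq_bigr => i _.
  by rewrite mE rowBA dotv_cons mulr0 add0r mulB'.
have <- : dotv w' w' = dotv w w.
  by rewrite -(dotv_mul_orthogonal w w AA) wA dotv_cons mulr0 add0r.
transitivity (std_gauss R n.+1 (split_event (B *m A) (w *m A) t1 t2)).
  rewrite -[RHS]GA; last exact: measurable_split_event.
  congr (std_gauss R n.+1 _); apply/seteqP; split => e;
    by rewrite /split_event /= trmx_mul -mulmxDl dotv_mul_orthogonal// -mulmxA
      (mulmxA A) AA mul1mx.
rewrite !std_gaussS subSS -ge0_integralZl//; last first.
  exact: (measurable_std_gauss_slice (@measurable_dotv_gt D.+1 t2)).
apply: eq_integral => x _.
(* The square [x ^+ 2] cancels in the residual and lowers the threshold for the second norm, which
   is why the induction ranges over all [t2]. *)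
transitivity (std_gauss R n (split_event B' w' t1 (t2 - x ^+ 2))).
  congr (std_gauss R n _); apply/seteqP; split => v;
    rewrite /split_event /= dotBA wA cons_rowD dotv_cons add0r -expr2 ltrBlDl;
    by rewrite opprD addrACA subrr add0r.
rewrite IHD//; congr (_ * std_gauss R D _)%E.
by apply/seteqP; split => v /=; rewrite dotv_cons -expr2 ltrBlDl.
Qed.

End chi2_independence.

(** * Orthonormal bases of subspaces and projections *)

Section orthonormal_basis.
Context {R : realType}.
Implicit Types n : nat.

Definition orthonormal_in n (S : {vspace 'rV[R]_n}) D (B : 'M[R]_(D, n)) :=
  B *m B^T = 1%:M /\ forall i, row i B \in S.

Lemma mulmx_memv n (S : {vspace 'rV[R]_n}) D (B : 'M[R]_(D, n)) (u : 'rV_D) :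
  (forall i, row i B \in S) -> u *m B \in S.
Proof.
by move=> BS; rewrite mulmx_sum_row; apply: memv_suml => i _; apply: memvZ.
Qed.

(** The right inverse [X] encodes independence of the rows in a form that lets dimensions be
    compared through products equal to the identity. *)
Lemma basis_mx n (S : {vspace 'rV[R]_n}) :
  exists (B : 'M[R]_(\dim S, n)) (X : 'M[R]_(n, \dim S)),
  [/\ B *m X = 1%:M, (forall i, row i B \in S) &
      forall v, v \in S -> exists u, v = u *m B].
Proof.
pose B : 'M[R]_(\dim S, n) := \matrix_(i, j) (vbasis S)`_i 0 j.
have rowB i : row i B = (vbasis S)`_i by apply/rowP => j; rewrite !mxE.
have mulB (u : 'rV[R]_(\dim S)) : u *m B = \sum_i u 0 i *: (vbasis S)`_i.
  by rewrite mulmx_sum_row; apply: eq_bigr => i _; rewrite rowB.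
have /row_freeP[X BX] : row_free B.
  rewrite -kermx_eq0; apply/eqP/row_matrixP => i; rewrite row0.
  set u := row i _.
  have uB0 : u *m B = 0 by apply/sub_kermxP; rewrite row_sub.
  have /freeP fB := basis_free (vbasisP S).
  apply/rowP => j; rewrite [RHS]mxE.
  by apply: (fB (fun k => u 0 k)); rewrite -mulB.
exists B, X; split => // [i|v /coord_vbasis vE].
  by rewrite rowB vbasis_mem// mem_nth// size_tuple.
exists (\row_i coord (vbasis S) i v).
by rewrite mulB [LHS]vE; apply: eq_bigr => i _; rewrite mxE.
Qed.

(** Writing [B] in a basis of [S] factors the identity [B *m B^T] of size [D] through dimension
    [\dim S]. *)
Lemma orthonormal_in_leq n (S : {vspace 'rV[R]_n}) D (B : 'M[R]_(D, n)) :
  orthonormal_in S B -> (D <= \dim S)%N.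
Proof.
move=> [BB BS]; have [B0 [X [_ _ SB0]]] := basis_mx S.
have /fin_all_exists[C CE] : forall i, exists u, row i B = u *m B0.
  by move=> i; exact: SB0.
have BE : B = (\matrix_i C i) *m B0.
  by apply/row_matrixP => i; rewrite row_mul rowK CE.
by move: BB; rewrite {1}BE -mulmxA => /mulmx1_min.
Qed.

(** One Gram-Schmidt step: the residual of [u], normalized, becomes the new row. *)
Lemma orthonormal_in_extend n (S : {vspace 'rV[R]_n}) D (B : 'M[R]_(D, n)) u :
  orthonormal_in S B -> u \in S -> u != u *m B^T *m B ->
  exists B' : 'M[R]_(D.+1, n), orthonormal_in S B'.
Proof.
move=> [BB BS] uS; rewrite -subr_eq0; set v := _ - _ => v0.
have vB : v *m B^T = 0 by rewrite mulmxBl -(mulmxA _ B) BB mulmx1 subrr.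
have vS : v \in S by rewrite memvB// mulmx_memv.
pose w := (enorm v)^-1 *: v.
have nv0 : enorm v != 0.
  by apply: contra_neq v0 => nv0; apply: dotvv_eq0; rewrite -sqr_enorm nv0 expr0n.
have wB : w *m B^T = 0 by rewrite -scalemxAl vB scaler0.
have ww : w *m w^T = 1%:M.
  rewrite [LHS]mx11_scalar -dotvE dotvZl dotvZr -sqr_enorm.
  by congr (_%:M); field.
exists (col_mx w B : 'M[R]_(1 + D, n)); split => [|i].
  rewrite (@tr_col_mx _ 1 D n) (@mul_col_row _ 1 D n 1 D) ww wB BB.
  rewrite -[B *m w^T]trmxK trmx_mul trmxK wB trmx0.
  by rewrite [RHS](@scalar_mx_block _ 1 D).
case: (@splitP 1 D i) => j ij.
  have -> : i = lshift D j by exact/val_inj.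
  rewrite (_ : row _ _ = w) ?memvZ//; apply/rowP => k.
  by rewrite mxE (@col_mxEu _ 1 D n) ord1.
have -> : i = rshift 1 j by exact/val_inj.
rewrite (_ : row _ _ = row j B)//; apply/rowP => k.
by rewrite mxE (@col_mxEd _ 1 D n) mxE.
Qed.

(** An orthonormal family of maximal length must reproduce every vector of [S], as the residual of a
    missed one would extend it. *)
Lemma orthonormal_basis n (S : {vspace 'rV[R]_n}) :
  exists2 B : 'M[R]_(\dim S, n), orthonormal_in S B &
    forall u, u \in S -> u = u *m B^T *m B.
Proof.
pose P D := `[< exists B : 'M[R]_(D, n), orthonormal_in S B >].
have P0 : P 0%N.
  apply/asboolP; exists 0; split => [|[]//].
  by apply/matrixP => -[].
have Ple D : P D -> (D <= \dim S)%N.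
  by move=> /asboolP[B]; exact: orthonormal_in_leq.
have [D /asboolP[B BS] Dmax] := ex_maxnP (ex_intro (fun D => P D) 0%N P0) Ple.
have SB u : u \in S -> u = u *m B^T *m B.
  move=> uS; apply/eqP/negPn/negP => uB.
  have PD : P D.+1 by exact/asboolP/(orthonormal_in_extend BS uS uB).
  by have := Dmax _ PD; rewrite ltnn.
have DS : D = \dim S.
  apply/eqP; rewrite eqn_leq (orthonormal_in_leq BS)/=.
  have [B0 [X [B0X B0S _]]] := basis_mx S.
  have B0E : B0 = B0 *m B^T *m B.
    by apply/row_matrixP => i; rewrite !row_mul; exact: SB.
  by move: B0X; rewrite {1}B0E -mulmxA => /mulmx1_min.
by rewrite -DS; exists B.
Qed.

Lemma orthoproj_mulmx n (S : {vspace 'rV[R]_n}) D (B : 'M[R]_(D, n)) x :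
  orthonormal_in S B -> (forall u, u \in S -> u = u *m B^T *m B) ->
  orthoproj S x = x *m B^T *m B.
Proof.
move=> [BB BS] SB; have [pS xp] := orthoprojP S x.
rewrite [LHS]SB//; congr (_ *m _); apply/eqP; rewrite eq_sym -subr_eq0.
rewrite -mulmxBl; apply/eqP/rowP => i; rewrite [RHS]mxE -(xp _ (BS i)) mxE.
by apply: eq_bigr => k _; rewrite !mxE.
Qed.

Lemma measurable_orthoproj n (S : {vspace 'rV[R]_n}) :
  measurable_fun setT (orthoproj S).
Proof.
have [B BS SB] := orthonormal_basis S.
rewrite (_ : orthoproj S = fun x => x *m (B^T *m B)).
  exact: measurable_mulmxr.
by apply/funext => x; rewrite (orthoproj_mulmx x BS SB) mulmxA.
Qed.

Lemma orthoproj_id n (S : {vspace 'rV[R]_n}) x : x \in S -> orthoproj S x = x.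
Proof.
by move=> xS; have [B BS SB] := orthonormal_basis S;
  rewrite (orthoproj_mulmx x BS SB) -SB.
Qed.

Lemma sqr_enorm_split n D (B : 'M[R]_(D, n)) (v : 'rV[R]_n) :
  B *m B^T = 1%:M ->
  dotv (v - v *m B^T *m B) (v - v *m B^T *m B) =
  dotv v v - dotv (v *m B^T) (v *m B^T).
Proof.
move=> BB; set g := v *m B^T.
have gg : dotv (g *m B) (g *m B) = dotv g g.
  by rewrite !dotvE trmx_mul mulmxA -(mulmxA g) BB mulmx1.
have vg : dotv v (g *m B) = dotv g g by rewrite !dotvE trmx_mul mulmxA.
have dN (x y : 'rV[R]_n) : dotv x (- y) = - dotv x y.
  by rewrite -scaleN1r dotvZr mulN1r.
rewrite dotvDl !dotvDr (dotvC (- _)) !dN (dotvC (- _)) dN gg vg opprK.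
by rewrite addNr addr0.
Qed.

End orthonormal_basis.

(** * Quantiles of right-continuous distribution functions *)

Section quantile.
Context {R : realType}.

(** Right continuity makes the infimum belong to the set, and right continuity at 0, where
    [F 0 = 0 < c], makes it strictly positive. *)
Lemma quantile_attained (F : R -> R) (c : R) :
  {homo F : x y / x <= y} -> right_continuous F -> F 0 = 0 ->
  F x @[x --> +oo] --> (1 : R) -> 0 < c < 1 ->
  exists q, [/\ 0 < q, c <= F q &
    ereal_inf [set x%:E | x in [set x | c <= F x]] = q%:E].
Proof.
move=> ndF rF F0 Fy /andP[c0 c1]; pose A := [set x | c <= F x].
have [x1 Ax1] : A !=set0.
  have [x /ltW cx] := filter_ex (cvgr_gt _ Fy _ c1).
  by exists x.
have lbA x : F x < c -> lbound A x.
  by move=> xc y; rewrite /A/= leNgt => /negP yc; rewrite leNgt; apply/negP => /ltW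
    /ndF /le_lt_trans /(_ xc).
have right_lt x : F x < c -> exists2 y, x < y & F y < c.
  move=> xc; have [y [? ?]] := filter_ex
    (filterI (nbhs_right_gt x) (cvgr_lt _ (rF x) _ xc)).
  by exists y.
have hlA : has_lbound A by exists 0; apply: lbA; rewrite F0.
have A0 : A !=set0 by exists x1.
exists (inf A); split; last by rewrite ereal_inf_EFin.
- have [y y0 yc] : exists2 y, 0 < y & F y < c by apply: right_lt; rewrite F0.
  by rewrite (lt_le_trans y0)// lb_le_inf//; exact: lbA.
- rewrite leNgt; apply/negP => /right_lt[y qy yc].
  have : y <= inf A by apply: lb_le_inf => //; exact: lbA.
  by rewrite leNgt qy.
Qed.

End quantile.

(** * Distribution functions and central quantiles of chi-square laws *)

Section nchi2_cdf.
Context {R : realType}.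
Implicit Types (n d : nat) (z t : R).
Local Notation N := (normal_prob (0 : R) 1).

Lemma measurable_dotv_le n (mu : 'rV[R]_n) t :
  measurable [set e | dotv (mu + e) (mu + e) <= t].
Proof.
rewrite (_ : mkset _ = (fun e => dotv (mu + e) (mu + e)) @^-1` `]-oo, t]).
  apply: measurable_preimage => //.
  exact: (measurable_dotv_diag (measurable_addv mu)).
by apply/seteqP; split => e /=; rewrite in_itv.
Qed.

Lemma nchi2_cdf_EFin z d t :
  (nchi2_cdf z d t%:E)%:E =
  std_gauss R d [set e | dotv (noncentral_mean z d + e)
                              (noncentral_mean z d + e) <= t].
Proof.
have le_itv : [set x : R | (x%:E <= t%:E)%E] = `]-oo, t]%classic.
  by apply/seteqP; split => x /=; rewrite lee_fin in_itv.
rewrite /nchi2_cdf le_itv fineK ?fin_num_measure//.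
rewrite /nchi2 /distribution /pushforward.
congr (std_gauss R d _); apply/seteqP; split => e /=;
  by rewrite /sqnorm_shift sqr_enorm in_itv.
Qed.

(** Identification with the distribution function of a random variable, from which monotonicity,
    right continuity and the limit at infinity are inherited. *)
Lemma nchi2_cdf_cdf z d :
  (fun t : R => (nchi2_cdf z d t%:E)%:E) =
  cdf (sqnorm_shift (noncentral_mean z d) : {RV (std_gauss R d) >-> R}).
Proof.
apply/funext => t; rewrite nchi2_cdf_EFin /cdf /distribution /pushforward.
congr (std_gauss R d _); apply/seteqP; split => e /=;
  by rewrite /sqnorm_shift sqr_enorm in_itv.
Qed.

Lemma nchi2_cdf_homo z d :
  {homo (fun t : R => nchi2_cdf z d t%:E) : t u / t <= u}.
Proof.
move=> t u tu; have := @cdf_nondecreasing _ _ _ _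
  (sqnorm_shift (noncentral_mean z d) : {RV (std_gauss R d) >-> R}) _ _ tu.
by rewrite -nchi2_cdf_cdf lee_fin.
Qed.

Lemma nchi2_cdf_le1 z d t : nchi2_cdf z d t%:E <= 1.
Proof.
rewrite -lee_fin nchi2_cdf_EFin; apply: probability_le1.
exact: measurable_dotv_le.
Qed.

Lemma cons_row_head n (x : R) (v : 'rV[R]_n) : cons_row (x, v) 0 0 = x.
Proof.
transitivity ((x%:M : 'M[R]_1) 0 0); last by rewrite mxE eqxx mulr1n.
rewrite -(@row_mxEl _ 1 1 n _ v 0 0) /cons_row /=.
by congr (row_mx _ _ _ _); apply/val_inj.
Qed.

(** Combined with [dotv_ge_head], this lets one-dimensional normal estimates control events on the
    norm. *)
Lemma std_gauss_head n (E : set R) : measurable E ->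
  std_gauss R n.+1 [set e | E (e 0 0)] = N E.
Proof.
move=> mE; rewrite std_gaussS -[RHS]mule1.
transitivity (\int[N]_x (\1_E x)%:E)%E; last by rewrite integral_indic ?setIT ?mule1.
apply: eq_integral => x _; rewrite indicE.
have hd := @cons_row_head n x.
case: (boolP (x \in E)) => [/set_mem xE|/negP xE].
  rewrite [X in std_gauss R n X](_ : _ = setT) ?probability_setT//.
  by apply/seteqP; split => // v _; rewrite /= hd.
rewrite [X in std_gauss R n X](_ : _ = set0) ?measure0//.
by apply/seteqP; split => // v; rewrite /= hd => /mem_set.
Qed.

Lemma measurable_head n (E : set R) : measurable E ->
  measurable [set e : 'rV[R]_n.+1 | E (e 0 0)].
Proof. by move=> mE; exact: (measurable_preimage (measurable_coord 0) mE). Qed.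

Lemma dotv_ge_head n (v : 'rV[R]_n.+1) : v 0 0 ^+ 2 <= dotv v v.
Proof.
rewrite /dotv big_ord_recl -expr2 lerDl.
by apply: sumr_ge0 => i _; rewrite -expr2 sqr_ge0.
Qed.

(** A zero norm forces the first coordinate to be 0, an event of normal probability 0. *)
Lemma nchi2_cdf0_0 d : (0 < d)%N -> nchi2_cdf (0 : R) d 0%:E = 0.
Proof.
case: d => // d _; apply/EFin_inj; rewrite nchi2_cdf_EFin; apply/eqP.
rewrite eq_le measure_ge0 andbT.
have N0 : N [set 0] = 0%E by rewrite /normal_prob integral_set1.
rewrite -[leRHS]N0.
rewrite -(@std_gauss_head d); last exact: measurable_set1.
apply: le_measure; rewrite ?inE; [exact: measurable_dotv_le| |].
  by apply: measurable_head; exact: measurable_set1.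
move=> e /= /(le_trans (dotv_ge_head _)).
rewrite noncentral_meanS sqrtr0 (_ : cons_row _ = 0) ?add0r; last first.
  by rewrite /cons_row /= raddf0 row_mx0.
by rewrite real_exprn_even_le0 ?num_real//= => /eqP.
Qed.

Lemma nchi2_quantile0E d u : (0 < d)%N -> 0 < u < 1 ->
  exists q : R, [/\ 0 < q, nchi2_quantile 0 d u = q%:E &
    1 - u <= nchi2_cdf 0 d q%:E].
Proof.
move=> d0 /andP[u0 u1].
have [|||||q [q0 cq qE]] :=
    @quantile_attained R (fun t => nchi2_cdf 0 d t%:E) (1 - u).
- exact: nchi2_cdf_homo.
- move=> x; have := @cdf_right_continuous _ _ _ _
    (sqnorm_shift (noncentral_mean 0 d) : {RV (std_gauss R d) >-> R}) x.
  by rewrite -nchi2_cdf_cdf => /fine_cvg.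
- exact: nchi2_cdf0_0.
- have := @cvg_cdfy1 _ _ _ _
    (sqnorm_shift (noncentral_mean 0 d) : {RV (std_gauss R d) >-> R}).
  by rewrite -nchi2_cdf_cdf => /fine_cvg.
- by apply/andP; split; lra.
by exists q; split => //; case: d d0 qE {cq} => // d _ <-.
Qed.

End nchi2_cdf.

(** * Dependence on the noncentrality parameter *)

Section nchi2_noncentrality.
Context {R : realType}.
Implicit Types (n d : nat) (a b z t s : R).
Local Notation N := (normal_prob (0 : R) 1).
Local Notation phi := (normal_pdf (0 : R) 1).
Local Notation mu := (@lebesgue_measure R).

Lemma normal_pdf_le (x y : R) : y ^+ 2 <= x ^+ 2 -> phi x <= phi y.
Proof.
move=> yx; rewrite !normal_pdf01E ler_wpM2l ?normal_peak_ge0// ler_expR.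
by rewrite !mulNr lerN2 ler_pM2r// invr_gt0.
Qed.

Lemma normal_itv_gt0 a b : a < b -> (0 < N `[a, b])%E.
Proof.
(* [c] is a lower bound of the density on the interval, where [x ^+ 2 <= a ^+ 2 + b ^+ 2]. *)
move=> ab; pose c := normal_peak 1 * expR (- (a ^+ 2 + b ^+ 2) / 2) : R.
have c0 : 0 < c by rewrite mulr_gt0 ?expR_gt0// normal_peak_gt0.
apply: (@lt_le_trans _ _ (\int[mu]_(x in `[a, b]) c%:E)%E).
  rewrite integral_cst//= lebesgue_measure_itv/= lte_fin ab -EFinD -EFinM.
  by rewrite lte_fin mulr_gt0// subr_gt0.
rewrite /normal_prob; apply: ge0_le_integral => //.
- by move=> x _; rewrite lee_fin ltW.
- apply/measurable_EFinP/measurable_funTS; exact: measurable_normal_pdf.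
- move=> x; rewrite /= in_itv/= => /andP[ax xb].
  rewrite lee_fin normal_pdf01E ler_wpM2l ?normal_peak_ge0// ler_expR.
  rewrite !mulNr lerN2 ler_pM2r ?invr_gt0//.
  have [x0|x0] := leP 0 x; first by nra.
  by nra.
Qed.

(** By induction, half of [t] is allotted to the first coordinate and half to the tail; a product of
    positive probabilities bounds that of the ball from below. *)
Lemma std_gauss_ball_gt0 n (m : 'rV[R]_n) t : 0 < t ->
  (0 < std_gauss R n [set e | (dotv (m + e) (m + e) <= t)%R])%E.
Proof.
elim: n m t => [|n IHn] m t t0.
  rewrite [X in std_gauss R 0 X](_ : _ = setT) ?probability_setT ?lte01//.
  by apply/seteqP; split => // e _ /=; rewrite (thinmx0 (m + e)) dotv0 ltW.
have [a [m' ->]] := cons_rowP m.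
pose r := Num.sqrt (t / 2).
have r0 : 0 < r by rewrite sqrtr_gt0 divr_gt0.
have r2 : r ^+ 2 = t / 2 by rewrite sqr_sqrtr// ltW// divr_gt0.
pose I : set (measurableTypeR R) := `[- a - r, - a + r]%classic.
have mI : measurable I by exact: measurable_itv.
have NI : (0 < N I)%E by apply: normal_itv_gt0; lra.
pose c := std_gauss R n [set v | (dotv (m' + v) (m' + v) <= t / 2)%R].
have c0 : (0 < c)%E by apply: IHn; rewrite divr_gt0.
apply: (@lt_le_trans _ _ (\int[N]_x (c * (\1_I x)%:E))%E).
  rewrite ge0_integralZl//; last exact: ltW.
    rewrite (_ : (\int[_]_x _)%E = N I); first exact: mule_gt0.
    by rewrite integral_indic ?setIT.
  exact/measurable_EFinP/measurable_indic.
rewrite std_gaussS; apply: ge0_le_integral => //.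
- by move=> x _; rewrite mule_ge0 ?(ltW c0)// lee_fin.
- by apply: emeasurable_funM => //; exact/measurable_EFinP/measurable_indic.
- exact: (measurable_std_gauss_slice (measurable_dotv_le _ _)).
move=> x _; rewrite indicE; case: (boolP (x \in I)) => [|_]; last by rewrite mule0.
rewrite inE /I /= in_itv/= mule1 => /andP[rx xr].
apply: le_measure; rewrite ?inE.
- exact: measurable_dotv_le.
- exact: (@measurable_cons_row_slice R n _ x (measurable_dotv_le _ _)).
move=> v /= vt; rewrite cons_rowD dotv_cons -expr2.
have -> : t = t / 2 + t / 2 by lra.
apply: lerD => //; rewrite -r2; nra.
Qed.

Lemma nchi2_cdf_gt0 z d t : 0 < t -> 0 < nchi2_cdf z d t%:E.
Proof. by move=> t0; rewrite -lte_fin nchi2_cdf_EFin std_gauss_ball_gt0. Qed.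

(** The identity of the line as a random variable under the normal law, so that the limit of
    distribution functions at minus infinity applies to that law. *)
Let id_mfun_mixin :=
  isMeasurableFun.Build _ _ (measurableTypeR R) R idfun
    (@measurable_id _ (measurableTypeR R) setT).
Let id_mfun : {RV N >-> R} :=
  HB.pack (idfun : measurableTypeR R -> R) id_mfun_mixin.

(** A far away mean forces the first noise coordinate deep into the left tail. One [Z] serves all
    [t <= t0], which later gives uniformity over the noise range. *)
Lemma nchi2_cdf_small d b t0 : (0 < d)%N -> 0 < b ->
  exists2 Z, 0 <= Z & forall z t, Z <= z -> t <= t0 -> nchi2_cdf z d t%:E <= b.
Proof.
case: d => // d _ b0.
have [r rb] : exists r, (N `]-oo, r] < b%:E)%E.
  have /fine_cvg cv := @cvg_cdfNy0 _ _ _ _ (id_mfun : {RV N >-> R}).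
  have [r rb] := filter_ex (cvgr_lt _ cv _ b0).
  exists r; rewrite -lte_fin in rb.
  by rewrite fineK ?fin_num_measure// in rb.
pose s := Num.sqrt t0.
have s0 : 0 <= s by exact: sqrtr_ge0.
(* With this choice [Num.sqrt z + x <= s] implies that [x] is at most minus the absolute value of
   [r], hence at most [r]. *)
exists ((s + `|r|) ^+ 2); first exact: sqr_ge0.
move=> z t Zz tt0; rewrite -lee_fin nchi2_cdf_EFin.
apply: le_trans (ltW rb); rewrite -(@std_gauss_head R d)//.
apply: le_measure; rewrite ?inE; first exact: measurable_dotv_le.
  exact: measurable_head.
have sz : s + `|r| <= Num.sqrt z.
  rewrite -(@ler_pXn2r _ 2)// ?nnegrE ?addr_ge0 ?sqrtr_ge0//.
  by rewrite sqr_sqrtr// (le_trans _ Zz)// sqr_ge0.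
move=> e /= /(le_trans (dotv_ge_head _)).
have [x [v ->]] := cons_rowP e.
rewrite noncentral_meanS cons_rowD !cons_row_head in_itv/= => xt.
have xs : Num.sqrt z + x <= s.
  rewrite (le_trans (ler_norm _))// -sqrtr_sqr ler_wsqrtr//.
  exact: le_trans tt0.
have := ler_norm (- r); rewrite normrN; lra.
Qed.

(* The reflection [x |-> - (a + b) - x] exchanges the two intervals and moves the
   part of the second one outside of the first one closer to the origin. *)
Lemma normal_shifted_itv a b s : 0 <= a -> a <= b ->
  (N [set x : R | ((b + x) ^+ 2 <= s)%R] <=
   N [set x : R | ((a + x) ^+ 2 <= s)%R])%E.
Proof.
move=> a0 ab.
have mI c : measurable [set x : R | (c + x) ^+ 2 <= s].
  rewrite (_ : mkset _ = (fun x : R => (c + x) ^+ 2) @^-1` `]-oo, s]).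
    apply: measurable_preimage => //; apply: measurable_funX.
    exact: measurable_funD.
  by apply/seteqP; split => x /=; rewrite in_itv.
set A := [set x : R | ((a + x) ^+ 2 <= s)%R]; set B := mkset _.
have mA : measurable A by exact: mI.
have mB : measurable B by exact: mI.
have NE (E : set R) : measurable E ->
    N E = (\int[mu]_x ((\1_E x)%:E * (phi x)%:E))%E.
  move=> mE; rewrite -ge0_integral_normal ?integral_indic ?setIT//.
  exact/measurable_EFinP/measurable_indic.
rewrite (measureDI N mB mA) (measureDI N mA mB) (setIC B A) leeD2r//.
have mBA : measurable (B `\` A) by exact: measurableD.
have mAB : measurable (A `\` B) by exact: measurableD.
have key (y : R) : (B `\` A) y ->
    (A `\` B) (- y + - (a + b)) /\ phi y <= phi (- y + - (a + b)).
  move=> [/= By /negP]; rewrite -ltNge => Ay.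
  have ea : b + (- y + - (a + b)) = - (a + y) by ring.
  have eb : a + (- y + - (a + b)) = - (b + y) by ring.
  split; first split => /=.
  - by rewrite /A /= eb sqrrN.
  - by rewrite /B /=; apply/negP; rewrite -ltNge ea sqrrN.
  apply: normal_pdf_le.
  (* For [y] in [B] but not in [A], [(b + y) ^+ 2 < (a + y) ^+ 2], and the difference of these
     squares factors as [(b - a) * (a + b + y *+ 2)]. *)
  have c0 : a + b + y *+ 2 <= 0.
    rewrite leNgt; apply/negP => c0; have := le_lt_trans By Ay.
    rewrite ltNge => /negP; apply; rewrite -subr_ge0.
    have -> : (b + y) ^+ 2 - (a + y) ^+ 2 = (b - a) * (a + b + y *+ 2) by ring.
    by rewrite mulr_ge0 ?subr_ge0// ltW.
  rewrite -subr_ge0.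
  have -> : y ^+ 2 - (- y - (a + b)) ^+ 2 = - ((a + b) * (a + b + y *+ 2)) by ring.
  by rewrite oppr_ge0 mulr_ge0_le0// addr_ge0// (le_trans a0).
rewrite [leLHS](NE _ mBA) [leRHS](NE _ mAB).
have mf (E : set R) : measurable E -> measurable_fun [set: measurableTypeR R]
    (fun x => ((\1_E x)%:E * (phi x)%:E)%E).
  move=> mE; apply: emeasurable_funM; apply/measurable_EFinP.
    exact: measurable_indic.
  exact: measurable_normal_pdf.
have f0 (E : set R) x : (0 <= (\1_E x)%:E * (phi x)%:E)%E.
  by rewrite mule_ge0 ?lee_fin ?normal_pdf_ge0.
(* A translation and a negation realize the reflection as a change of variable. *)
rewrite -[leRHS](ge0_integral_shift (- (a + b))); [|exact: mf|exact: f0].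
rewrite -[leRHS]ge0_integral_opp; last 2 first.
- apply: (measurableT_comp (mf _ mAB)); exact: measurable_funD.
- by move=> x; exact: f0.
apply: ge0_le_integral => //.
- exact: mf.
- apply: (measurableT_comp (mf _ mAB)); apply: measurable_funD => //.
move=> x _; rewrite !indicE; case: (boolP (x \in B `\` A)) => [|_]; last first.
  by rewrite mul0e; rewrite mule_ge0 ?lee_fin ?normal_pdf_ge0.
by move=> /set_mem /key[/mem_set -> ?]; rewrite !mul1e lee_fin.
Qed.

(** Only the first coordinate sees the mean: for a fixed tail [v], the event concerns a single
    shifted normal variable and [normal_shifted_itv] applies. *)
Lemma nchi2_cdf_noninc z1 z2 d t : 0 <= z1 -> z1 <= z2 ->
  nchi2_cdf z2 d t%:E <= nchi2_cdf z1 d t%:E.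
Proof.
move=> z10 z12; rewrite -lee_fin !nchi2_cdf_EFin; case: d => [|d].
  by rewrite (thinmx0 (noncentral_mean z1 0)) (thinmx0 (noncentral_mean z2 0)).
pose E z : set (measurableTypeR R * 'rV[R]_d) :=
  @cons_row R d @^-1`
  [set e | dotv (noncentral_mean z d.+1 + e) (noncentral_mean z d.+1 + e) <= t].
have mE z : measurable (E z).
  by apply: measurable_preimage => //; exact: measurable_dotv_le.
have swap z : std_gauss R d.+1
    [set e | dotv (noncentral_mean z d.+1 + e) (noncentral_mean z d.+1 + e) <= t]
    = (\int[std_gauss R d]_v N [set x : R | ((Num.sqrt z + x) ^+ 2 <=
         t - dotv v v)%R])%E.
  have := indic_fubini_tonelli N (std_gauss R d) (mE z).
  rewrite indic_fubini_tonelli_FE// indic_fubini_tonelli_GE// => H.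
  rewrite std_gaussS; transitivity (\int[N]_x (std_gauss R d \o xsection (E z)) x)%E.
    by apply: eq_integral => x _ /=; rewrite xsectionE.
  rewrite H; apply: eq_integral => v _ /=; rewrite ysectionE.
  congr (N _); apply/seteqP; split => x;
    by rewrite /E /= noncentral_meanS cons_rowD dotv_cons add0r -expr2 lerBrDr.
have mG z : measurable_fun setT (fun v : 'rV[R]_d =>
    N [set x : R | ((Num.sqrt z + x) ^+ 2 <= t - dotv v v)%R]).
  have := measurable_fun_ysection N (mE z); congr (measurable_fun _ _).
  apply/funext => v /=; rewrite ysectionE; congr (N _).
  by apply/seteqP; split => x;
    rewrite /E /= noncentral_meanS cons_rowD dotv_cons add0r -expr2 lerBrDr.
rewrite !swap; apply: ge0_le_integral => //.
by move=> v _; apply: normal_shifted_itv; rewrite ?sqrtr_ge0// ler_wsqrtr.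
Qed.

End nchi2_noncentrality.

(** * The Gaussian model decomposed along a subspace *)

Section model.
Context {R : realType}.
Implicit Types n : nat.

Lemma gauss_lawE n (f : 'rV[R]_n) s (E : set 'rV[R]_n) :
  gauss_law f s E = std_gauss R n [set e | E (gauss_obs f s e)].
Proof. by []. Qed.

(** [w] is the component of [f] orthogonal to [S], divided by [s]. In units of [s], the residual of
    the observation involves only the noise outside [S], and the loss only the noise inside [S],
    each on top of the bias [w]. *)
Lemma gauss_model_split n (S : {vspace 'rV[R]_n}) (f : 'rV[R]_n) s : 0 < s ->
  exists (B : 'M[R]_(\dim S, n)) (w : 'rV[R]_n),
  [/\ B *m B^T = 1%:M, w *m B^T = 0,
      dotv w w = enorm (f - orthoproj S f) ^+ 2 / s ^+ 2,
      forall e, enorm (gauss_obs f s e - orthoproj S (gauss_obs f s e)) ^+ 2 =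
        s ^+ 2 * (dotv (w + e) (w + e) - dotv (e *m B^T) (e *m B^T)) &
      forall e, enorm (f - orthoproj S (gauss_obs f s e)) ^+ 2 =
        s ^+ 2 * (dotv w w + dotv (e *m B^T) (e *m B^T))].
Proof.
move=> s0; have [B BS SB] := orthonormal_basis S; have [BB _] := BS.
have PE x : orthoproj S x = x *m B^T *m B := orthoproj_mulmx x BS SB.
pose w := s^-1 *: (f - f *m B^T *m B).
have wE : s *: w = f - f *m B^T *m B by rewrite scalerA divff ?scale1r// gt_eqF.
have wB : w *m B^T = 0.
  by rewrite -scalemxAl mulmxBl -(mulmxA _ B) BB mulmx1 subrr scaler0.
clearbody w; exists B, w; split => //.
- rewrite sqr_enorm PE -wE dotvZl dotvZr.
  by field; rewrite gt_eqF.
- move=> e; rewrite sqr_enorm PE.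
  have -> : gauss_obs f s e - gauss_obs f s e *m B^T *m B =
      s *: ((w + e) - (w + e) *m B^T *m B).
    rewrite (mulmxDl w e) wB add0r scalerBr scalerDr wE /gauss_obs !mulmxDl.
    by rewrite -!scalemxAl opprD addrACA addrA.
  rewrite dotvZl dotvZr mulrA -expr2 sqr_enorm_split//.
  by rewrite mulmxDl wB add0r.
- move=> e; rewrite sqr_enorm PE.
  have -> : f - gauss_obs f s e *m B^T *m B = s *: (w - e *m B^T *m B).
    by rewrite scalerBr wE /gauss_obs !mulmxDl -!scalemxAl opprD addrA.
  rewrite dotvZl dotvZr mulrA -expr2; congr (_ * _).
  set g := e *m B^T.
  have gg : dotv (g *m B) (g *m B) = dotv g g.
    by rewrite !dotvE trmx_mul mulmxA -(mulmxA g) BB mulmx1.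
  have wg : dotv w (g *m B) = 0.
    by rewrite dotvE trmx_mul mulmxA wB mul0mx mxE.
  rewrite -[- (g *m B)]scaleN1r dotvDl !dotvDr (dotvC (_ *: _) w).
  rewrite !dotvZr wg mulr0 addr0 add0r dotvZl gg; ring.
Qed.

(** The residual is 0, and so is the threshold, by the convention on quantiles with zero degrees of
    freedom. *)
Lemma accepted_codim0 n (M : finType) (S : M -> {vspace 'rV[R]_n})
    (alpha tau : R) y m :
  S m = fullv -> accepted S alpha tau y m.
Proof.
move=> Sm; rewrite /accepted /= Sm orthoproj_id ?memvf//.
rewrite subrr sqr_enorm dotv0 /codim dimvf /= dim_matrix mul1r subnn.
by rewrite mul0e.
Qed.

Lemma std_gauss_dotv_gt d u q : 1 - u <= nchi2_cdf 0 d q%:E ->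
  (std_gauss R d [set e | (q < dotv e e)%R] <= u%:E)%E.
Proof.
move=> uq; rewrite (_ : mkset _ =
  ~` [set e | dotv (noncentral_mean 0 d + e) (noncentral_mean 0 d + e) <= q]).
  rewrite probability_setC; last exact: measurable_dotv_le.
  by rewrite -nchi2_cdf_EFin -EFinB lee_fin; lra.
have -> : noncentral_mean 0 d = 0 :> 'rV[R]_d.
  by apply/rowP => i; rewrite !mxE sqrtr0 if_same.
by apply/seteqP; split => e /=; rewrite add0r ltNge => /negP.
Qed.

Lemma enorm_le n (v : 'rV[R]_n) r : 0 <= r ->
  (enorm v <= r) = (dotv v v <= r ^+ 2).
Proof. by move=> r0; rewrite -sqr_enorm ler_pXn2r// nnegrE// enorm_ge0. Qed.

(** For negative [r], [Num.sqrt r] is 0 and [r] lies below any square. *)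
Lemma sqrt_lt_enorm n (v : 'rV[R]_n) r :
  Num.sqrt r < enorm v -> r < enorm v ^+ 2.
Proof.
move=> rv; rewrite -[X in _ < X](sqr_sqrtr (sqr_ge0 _)).
have [r0|r0] := leP 0 r.
  rewrite -(sqr_sqrtr r0) ltr_pXn2r// ?nnegrE ?sqrtr_ge0//.
  by rewrite (lt_le_trans rv)// sqrtr_sqr ler_norm.
by rewrite (lt_le_trans r0)// sqr_ge0.
Qed.

End model.

(** * Acceptance probabilities and confidence bounds *)

Section confidence_ball.
Variables (R : realType) (n : nat) (alpha tau eta sigma : R).
Variables (M : finType) (top : M) (S : M -> {vspace 'rV[R]_n}) (beta_ : M -> R).
Hypothesis n_gt0 : (0 < n)%N.
Hypothesis alpha01 : 0 < alpha < 1.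
Hypothesis tau_gt0 : 0 < tau.
Hypothesis eta01 : 0 <= eta < 1.
Hypothesis sigmaI : noise_range tau eta sigma.
Hypothesis S_top : S top = fullv.
Hypothesis dim_lt : forall m, m != top -> (\dim (S m) < n)%N.
Hypothesis beta01 : forall m, 0 < beta_ m < 1.

Let smin := Num.sqrt (1 - eta) * tau.

Let smin_gt0 : 0 < smin.
Proof. by rewrite mulr_gt0// sqrtr_gt0; case/andP: eta01; lra. Qed.

Let noise_range_bounds s : noise_range tau eta s -> smin <= s <= tau.
Proof. by rewrite /noise_range /= in_itv. Qed.

Let noise_range_gt0 s : noise_range tau eta s -> 0 < s.
Proof. by move=> /noise_range_bounds/andP[? _]; exact: lt_le_trans smin_gt0 _. Qed.

Let sigma_gt0 : 0 < sigma := noise_range_gt0 sigmaI.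

Let codim_gt0 m : m != top -> (0 < codim (S m))%N.
Proof. by move=> mt; rewrite subn_gt0 dim_lt. Qed.


(** As [eta < 1], the noise range stays away from 0, and acceptance thresholds are bounded uniformly
    over it. *)
Lemma noise_ratio_le s : noise_range tau eta s ->
  tau ^+ 2 / s ^+ 2 <= tau ^+ 2 / smin ^+ 2.
Proof.
move=> sI; have /andP[ss _] := noise_range_bounds sI.
rewrite ler_wpM2l ?sqr_ge0// lef_pV2 ?posrE ?exprn_gt0// ?(noise_range_gt0 sI)//.
by rewrite ler_pXn2r// nnegrE ltW// (noise_range_gt0 sI).
Qed.

Lemma noise_ratio_ge1 s : noise_range tau eta s -> 1 <= tau ^+ 2 / s ^+ 2.
Proof.
move=> sI; have /andP[_ st] := noise_range_bounds sI.
have s0 := noise_range_gt0 sI.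
by rewrite ler_pdivlMr ?exprn_gt0// mul1r ler_pXn2r// nnegrE ltW.
Qed.

Let resid_nc m (f : 'rV[R]_n) :=
  enorm (f - orthoproj (S m) f) ^+ 2 / sigma ^+ 2.

(** Acceptance concerns the noise outside [S m], the excess over the bias the noise inside; their
    independence gives the product. *)
Lemma accepted_excess_prob m f q t :
  nchi2_quantile 0 (codim (S m)) alpha = q%:E ->
  gauss_law f sigma [set y | accepted S alpha tau y m /\
    resid_nc m f * sigma ^+ 2 + t * sigma ^+ 2 <
      enorm (f - orthoproj (S m) y) ^+ 2] =
  ((nchi2_cdf (resid_nc m f) (codim (S m))
     (q * (tau ^+ 2 / sigma ^+ 2))%:E)%:E *
   std_gauss R (\dim (S m)) [set e | (t < dotv e e)%R])%E.
Proof.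
move=> qE; rewrite /resid_nc.
have [B [w [BB wB <- acc exc]]] := gauss_model_split (S m) f sigma_gt0.
rewrite gauss_lawE nchi2_cdf_EFin.
have s20 : 0 < sigma ^+ 2 by rewrite exprn_gt0.
have leE x : (sigma ^+ 2 * x <= q * tau ^+ 2) =
    (x <= q * (tau ^+ 2 / sigma ^+ 2)).
  by rewrite mulrA ler_pdivlMr// mulrC.
have ltE a b : (a * sigma ^+ 2 + t * sigma ^+ 2 < sigma ^+ 2 * (a + b)) =
    (t < b).
  by rewrite -mulrDl mulrC ltr_pM2l// ltrD2l.
transitivity (std_gauss R n
    (split_event B w (q * (tau ^+ 2 / sigma ^+ 2)) t)).
  congr (std_gauss R n _); apply/seteqP; split => e;
    rewrite /split_event /accepted /= acc qE -EFinM lee_fin exc;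
    by rewrite leE ltE.
rewrite gauss_split_event//; congr (_ * _)%E.
rewrite /nchi2 /distribution /pushforward /codim.
by congr (std_gauss R _ _); apply/seteqP; split => e /=;
  rewrite /sqnorm_shift sqr_enorm.
Qed.

Lemma accepted_prob m f q : nchi2_quantile 0 (codim (S m)) alpha = q%:E ->
  gauss_law f sigma [set y | accepted S alpha tau y m] =
  (nchi2_cdf (resid_nc m f) (codim (S m))
     (q * (tau ^+ 2 / sigma ^+ 2))%:E)%:E.
Proof.
(* The threshold -1 makes the excess condition hold for certain. *)
move=> qE; have := accepted_excess_prob f (-1) qE.
rewrite [X in (_ * std_gauss R _ X)%E](_ : _ = setT); last first.
  by apply/seteqP; split => // e _ /=; rewrite (lt_le_trans _ (dotvv_ge0 _)).
rewrite probability_setT mule1 => <-.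
have [B [w [BB wB wE acc exc]]] := gauss_model_split (S m) f sigma_gt0.
rewrite !gauss_lawE; congr (std_gauss R n _).
apply/seteqP; split => e /= => [ae|[]//]; split => //.
rewrite exc wE -/(resid_nc m f) -mulrDl mulrC ltr_pM2l ?exprn_gt0//.
by rewrite ltrD2l (lt_le_trans _ (dotvv_ge0 _)).
Qed.

Lemma codim_quantile m : m != top -> exists q : R, [/\ 0 < q,
  nchi2_quantile 0 (codim (S m)) alpha = q%:E &
  1 - alpha <= nchi2_cdf 0 (codim (S m)) q%:E].
Proof. by move=> mt; exact: nchi2_quantile0E (codim_gt0 mt) alpha01. Qed.

Lemma measurable_accepted m : measurable [set y | accepted S alpha tau y m].
Proof.
have [->|mt] := eqVneq m top.
  rewrite (_ : mkset _ = setT) //.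
  by apply/seteqP; split => // y _; exact: accepted_codim0.
have [q [_ qE _]] := codim_quantile mt.
rewrite (_ : mkset _ = (fun y => dotv (y - orthoproj (S m) y)
    (y - orthoproj (S m) y)) @^-1` `]-oo, q * tau ^+ 2]).
  apply: measurable_preimage => //; apply: measurable_dotv_diag.
  apply: measurable_fun_rowP => i; under eq_fun do rewrite !mxE.
  apply: measurable_funB; first exact: measurable_coord.
  exact: (measurableT_comp (measurable_coord i) (measurable_orthoproj (S m))).
by apply/seteqP; split => y;
  rewrite /accepted /= qE -EFinM lee_fin sqr_enorm in_itv.
Qed.

(** For [m != top] the noncentrality is 0, and [sigma <= tau] keeps the rescaled threshold at or
    above the quantile. *)
Lemma accepted_prob_ge m f : f \in S m ->
  ((1 - alpha)%:E <= gauss_law f sigma [set y | accepted S alpha tau y m])%E.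
Proof.
move=> fS; have [mt|mt] := eqVneq m top.
  rewrite (_ : mkset _ = setT) ?probability_setT ?lee_fin; last first.
    by apply/seteqP; split => // y _; apply: accepted_codim0; rewrite mt.
  by case/andP: alpha01; lra.
have [q [q0 qE qa]] := codim_quantile mt.
rewrite (accepted_prob f qE) lee_fin /resid_nc orthoproj_id// subrr.
rewrite sqr_enorm dotv0 mul0r (le_trans qa)// nchi2_cdf_homo//.
by rewrite ler_peMr ?(ltW q0)// noise_ratio_ge1.
Qed.

(** * Probability that an accepted model misses the mean *)

Let radius := conf_radius top S beta_ alpha tau eta.

(** Failure is charged to a fixed index, so that the bounds below do not involve the selection
    rule. *)
Let bad m f : set 'rV[R]_n := [set y | accepted S alpha tau y m /\
  radius m < enorm (f - orthoproj (S m) y)].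

Lemma measurable_orthoproj_dist m f :
  measurable_fun setT (fun y => dotv (f - orthoproj (S m) y)
    (f - orthoproj (S m) y)).
Proof.
apply: measurable_dotv_diag; apply: measurable_fun_rowP => i.
under eq_fun do rewrite !mxE.
apply: measurable_funB => //.
exact: (measurableT_comp (measurable_coord i) (measurable_orthoproj (S m))).
Qed.

Lemma measurable_covered m f :
  measurable [set y | enorm (f - orthoproj (S m) y) <= radius m].
Proof.
rewrite (_ : mkset _ = (fun y => dotv (f - orthoproj (S m) y)
    (f - orthoproj (S m) y)) @^-1` `]-oo, radius m ^+ 2]).
  by apply: measurable_preimage => //; exact: measurable_orthoproj_dist.
by apply/seteqP; split => y; rewrite /= in_itv/= enorm_le// sqrtr_ge0.
Qed.

Lemma measurable_bad m f : measurable (bad m f).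
Proof.
rewrite (_ : bad m f = [set y | accepted S alpha tau y m] `\`
    [set y | enorm (f - orthoproj (S m) y) <= radius m]).
  by apply: measurableD; [exact: measurable_accepted|exact: measurable_covered].
apply/seteqP; split => y [ya] /=; rewrite ?ltNge => /negP ym; first by split.
by split => //; rewrite ltNge.
Qed.

Lemma measurable_excess m f c :
  measurable [set y | accepted S alpha tau y m /\
    c < enorm (f - orthoproj (S m) y) ^+ 2].
Proof.
rewrite (_ : mkset _ = [set y | accepted S alpha tau y m] `&`
    (fun y => dotv (f - orthoproj (S m) y)
    (f - orthoproj (S m) y)) @^-1` `]c, +oo[).
  apply: measurableI; first exact: measurable_accepted.
  by apply: measurable_preimage => //; exact: measurable_orthoproj_dist.
by apply/seteqP; split => y; rewrite /= sqr_enorm in_itv/= andbT.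
Qed.

Lemma bad_prob_le_accepted m f :
  (gauss_law f sigma (bad m f) <=
   gauss_law f sigma [set y | accepted S alpha tau y m])%E.
Proof.
apply: le_measure; rewrite ?inE; [exact: measurable_bad| |by move=> y []].
exact: measurable_accepted.
Qed.

Lemma bad_prob_top f : (gauss_law f sigma (bad top f) <= (beta_ top)%:E)%E.
Proof.
have [q [q0 qE qb]] := nchi2_quantile0E n_gt0 (beta01 top).
have radE : radius top = Num.sqrt (q * tau ^+ 2).
  by rewrite /radius /conf_radius /conf_radius_sq eqxx qE -EFinM.
apply: le_trans (std_gauss_dotv_gt qb); rewrite gauss_lawE.
apply: le_measure; rewrite ?inE; last 2 first.
- exact: measurable_dotv_gt.
- move=> e [_]; rewrite /= radE S_top orthoproj_id ?memvf// => /sqrt_lt_enorm.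
  rewrite /gauss_obs opprD addNKr -scaleN1r scalerA sqr_enorm dotvZl dotvZr.
  rewrite mulrA -expr2 mulN1r sqrrN mulrC => lt_q.
  rewrite -(@ltr_pM2l _ (tau ^+ 2)) ?exprn_gt0//; apply: lt_le_trans lt_q _.
  rewrite ler_wpM2r ?dotvv_ge0//.
  have /andP[_ st] := noise_range_bounds sigmaI.
  by rewrite ler_pXn2r// nnegrE ltW.
exact: (measurable_preimage (measurable_gauss_obs f sigma) (measurable_bad _ _)).
Qed.

Lemma nchi2_cdf_small_unif m q b : m != top -> 0 < q -> 0 < b ->
  exists2 Z, 0 <= Z & forall z s, Z <= z -> noise_range tau eta s ->
    nchi2_cdf z (codim (S m)) (q * (tau ^+ 2 / s ^+ 2))%:E <= b.
Proof.
move=> mt q0 b0.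
have [Z Z0 HZ] := nchi2_cdf_small (q * (tau ^+ 2 / smin ^+ 2)) (codim_gt0 mt) b0.
exists Z => // z s Zz sI; apply: HZ => //.
by rewrite ler_wpM2l ?noise_ratio_le// ltW.
Qed.

Lemma nchi2_quantile1 d : (0 < d)%N -> nchi2_quantile (0 : R) d 1 = -oo%E.
Proof.
case: d => // d _; apply: eq_ninfty => A; apply: ereal_inf_lbound.
exists A => //=; rewrite subrr -lee_fin nchi2_cdf_EFin.
exact: measure_ge0.
Qed.

Lemma nchi2_quantile_le d u v (t : R) : (0 < d)%N -> u <= v ->
  1 - u <= nchi2_cdf 0 d t%:E -> (nchi2_quantile 0 d v <= t%:E)%E.
Proof.
case: d => // d _ uv ut; apply: ereal_inf_lbound; exists t => //=.
by apply: le_trans ut; lra.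
Qed.

Lemma bad_prob_pos m f : m != top -> (0 < \dim (S m))%N ->
  (gauss_law f sigma (bad m f) <= (beta_ m)%:E)%E.
Proof.
move=> mt D0; have [q [q0 qE qa]] := codim_quantile mt.
have /andP[b0 b1] := beta01 m.
have [qb [qb0 qbE qbb]] := nchi2_quantile0E D0 (beta01 m).
set N := codim (S m) in qE qa; set D := \dim (S m) in D0 qbE qbb.
pose p z s := nchi2_cdf z N (q * (tau ^+ 2 / s ^+ 2))%:E.
pose u z s := Num.min (beta_ m / p z s) 1.
pose V := [set ((z * s ^+ 2)%:E + nchi2_quantile 0 D (u z s) * (s ^+ 2)%:E)%E
  | z in [set z : R | 0 <= z] & s in noise_range tau eta].
have radE : radius m = Num.sqrt (fine (ereal_sup V)).
  rewrite /radius /conf_radius /conf_radius_sq (negbTE mt) D0 -/N -/D.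
  by rewrite qE.
have p0 z s : noise_range tau eta s -> 0 < p z s.
  move=> sI; apply: nchi2_cdf_gt0; rewrite mulr_gt0//.
  by apply: lt_le_trans (noise_ratio_ge1 sI).
have p1 z s : p z s <= 1 by exact: nchi2_cdf_le1.
have ub z s : noise_range tau eta s -> beta_ m <= u z s.
  move=> sI; rewrite /u le_min (ltW b1) andbT ler_pdivlMr ?p0//.
  by rewrite ler_piMr ?p1// ltW.
have quant_le v : beta_ m <= v -> (nchi2_quantile 0 D v <= qb%:E)%E.
  by move=> bv; exact: nchi2_quantile_le bv qbb.
(* For large [z] the quantile is taken at [1], where it is [-oo]; for the others
   it is taken at some [u >= beta_ m]. *)
have V_le : exists C : R, (ereal_sup V <= C%:E)%E.
  have [Z Z0 HZ] := nchi2_cdf_small_unif mt q0 b0.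
  exists (Z * tau ^+ 2 + qb * tau ^+ 2).
  apply: ge_ereal_sup => _ [z z0 [s sI <-]].
  have s0 := noise_range_gt0 sI.
  have s2 : 0 < s ^+ 2 by rewrite exprn_gt0.
  have st : s ^+ 2 <= tau ^+ 2.
    have /andP[_ st] := noise_range_bounds sI.
    by rewrite ler_pXn2r// nnegrE ltW.
  have [Zz|zZ] := leP Z z.
    have -> : u z s = 1.
      by apply/min_idPr; rewrite ler_pdivlMr ?p0// mul1r; exact: HZ.
    by rewrite nchi2_quantile1// mulNyr gtr0_sg// mul1e addeNy leNye.
  rewrite EFinD; apply: leeD.
    by rewrite lee_fin ler_pM// ltW.
  apply: (@le_trans _ _ (qb%:E * (s ^+ 2)%:E)%E).
    by apply: lee_wpmul2r; rewrite ?lee_fin ?(ltW s2)// quant_le// ub.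
  by rewrite -EFinM lee_fin ler_wpM2l// ltW.
pose z := resid_nc m f.
have z0 : 0 <= z by rewrite divr_ge0// sqr_ge0.
(* If acceptance is already rare enough, it settles the bound; otherwise the minimum in [u] is the
   ratio, which is below 1. *)
have [pb|bp] := leP (p z sigma) (beta_ m).
  apply: le_trans (bad_prob_le_accepted _ _) _.
  by rewrite (accepted_prob f qE) lee_fin.
have uE : u z sigma = beta_ m / p z sigma.
  by apply/min_idPl; rewrite ler_pdivrMr ?p0// mul1r ltW.
have u01 : 0 < beta_ m / p z sigma < 1.
  by rewrite divr_gt0 ?p0//= ltr_pdivrMr ?p0// mul1r.
have [v [v0 vE vu]] := nchi2_quantile0E D0 u01.
(* The true pair [(z, sigma)] enters the supremum. Finiteness matters, since [fine] maps infinite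
   values to 0. *)
have radius_ge : z * sigma ^+ 2 + v * sigma ^+ 2 <= fine (ereal_sup V).
  have [C VC] := V_le.
  have VZ : ((z * sigma ^+ 2 + v * sigma ^+ 2)%:E <= ereal_sup V)%E.
    apply: ereal_sup_ubound; exists z => //; exists sigma => //.
    by rewrite uE vE EFinD -EFinM.
  rewrite -lee_fin fineK// fin_numElt (lt_le_trans (ltNyr _) VZ)/=.
  exact: le_lt_trans VC (ltry _).
(* Acceptance probability times a bound on the excess probability: the factor [p z sigma]
   cancels. *)
apply: (@le_trans _ _ ((p z sigma)%:E * (beta_ m / p z sigma)%:E)%E); last first.
  by rewrite -EFinM mulrC divfK// gt_eqF// p0.
apply: (@le_trans _ _ ((p z sigma)%:E *
    std_gauss R D [set e | (v < dotv e e)%R])%E); last first.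
  apply: lee_wpmul2l; first by rewrite lee_fin ltW// p0.
  exact: std_gauss_dotv_gt.
rewrite -(accepted_excess_prob f v qE); apply: le_measure; rewrite ?inE.
- exact: measurable_bad.
- exact: measurable_excess.
- move=> y [ya]; rewrite radE => /sqrt_lt_enorm; split => //.
  exact: le_lt_trans radius_ge _.
Qed.

(* Here [f - Pi_m Y = f] is deterministic, so the bound comes from acceptance
   alone and needs the noncentral distribution function to decrease in [z]. *)
Lemma bad_prob_zero m f : m != top -> \dim (S m) = 0 ->
  (gauss_law f sigma (bad m f) <= (beta_ m)%:E)%E.
Proof.
move=> mt D0; have [q [q0 qE qa]] := codim_quantile mt.
have /andP[b0 b1] := beta01 m.
have codimE : codim (S m) = n by rewrite /codim D0 subn0.
have qnE : nchi2_quantile 0 n alpha = q%:E by rewrite -codimE.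
pose X := [set x : R | 0 <= x /\
  (ereal_sup [set (nchi2_cdf (x / s ^+ 2) n
      (q * (tau ^+ 2 / s ^+ 2))%:E)%:E | s in noise_range tau eta]
   <= (beta_ m)%:E)%E].
have radE : radius m = Num.sqrt (fine (ereal_inf [set x%:E | x in X])).
  rewrite /radius /conf_radius /conf_radius_sq (negbTE mt) D0 /=.
  by rewrite qnE.
(* For [x = Z * tau ^+ 2] the noncentrality [x / s ^+ 2] is at least [Z] for all [s] in the range.
   With the lower bound 0, this makes the infimum a real number. *)
have X0 : X !=set0.
  have [Z Z0 HZ] := nchi2_cdf_small_unif mt q0 b0.
  exists (Z * tau ^+ 2); split; first by rewrite mulr_ge0// sqr_ge0.
  apply: ge_ereal_sup => _ [s sI <-]; rewrite lee_fin -codimE; apply: HZ => //.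
  by rewrite -mulrA ler_peMr// noise_ratio_ge1.
have lbX : has_lbound X by exists 0 => x [].
have {}radE : radius m = Num.sqrt (inf X) by rewrite radE ereal_inf_EFin.
have projE y : orthoproj (S m) y = 0.
  have [yS _] := orthoprojP (S m) y.
  have /eqP := D0; rewrite dimv_eq0 => /eqP S0.
  by move: yS; rewrite S0 memv0 => /eqP.
have [fle|fgt] := leP (enorm f) (radius m).
  rewrite (_ : bad m f = set0) ?measure0 ?lee_fin ?ltW//.
  by apply/seteqP; split => // y [_]; rewrite projE subr0 ltNge fle.
apply: le_trans (bad_prob_le_accepted _ _) _.
rewrite (accepted_prob f qE) lee_fin /resid_nc projE subr0 codimE.
have Xf : inf X < enorm f ^+ 2 by apply: sqrt_lt_enorm; rewrite -radE.
(* Some member of the set lies below [enorm f ^+ 2], and monotonicity in the noncentrality carries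
   its bound over to [f]. *)
have [x [x0 Xx] xf] : exists2 x, X x & x < enorm f ^+ 2.
  apply: contrapT => nx; move: Xf; rewrite ltNge => /negP; apply.
  apply: lb_le_inf => // x Xx; rewrite leNgt; apply/negP => xf.
  by apply: nx; exists x.
apply: (@le_trans _ _ (nchi2_cdf (x / sigma ^+ 2) n
    (q * (tau ^+ 2 / sigma ^+ 2))%:E)).
  apply: nchi2_cdf_noninc; first by rewrite divr_ge0// sqr_ge0.
  by rewrite ler_wpM2r ?invr_ge0 ?sqr_ge0// ltW.
by rewrite -lee_fin; apply: le_trans Xx; apply: ereal_sup_ubound; exists sigma.
Qed.

Lemma bad_prob m f : (gauss_law f sigma (bad m f) <= (beta_ m)%:E)%E.
Proof.
have [->|mt] := eqVneq m top; first exact: bad_prob_top.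
case: (posnP (\dim (S m))) => D0; first exact: bad_prob_zero.
exact: bad_prob_pos.
Qed.

(** Measurability is carried along the induction, as subadditivity on two sets requires it. *)
Lemma bad_union_prob f :
  measurable (\bigcup_(m in [set: M]) bad m f) /\
  (gauss_law f sigma (\bigcup_(m in [set: M]) bad m f) <=
   (\sum_m beta_ m)%:E)%E.
Proof.
rewrite -sumEFin (_ : \bigcup_(_ in _) _ = \big[setU/set0]_m bad m f).
  apply: (big_ind2 (fun E x => measurable E /\ (gauss_law f sigma E <= x)%E)).
  - by rewrite measure0.
  - move=> E1 x1 E2 x2 [mE1 Ex1] [mE2 Ex2]; split; first exact: measurableU.
    exact: le_trans (measureU2 _ mE1 mE2) (leeD Ex1 Ex2).
  - by move=> m _; split; [exact: measurable_bad|exact: bad_prob].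
apply/seteqP; split => y.
  by move=> [m _ ym]; rewrite (bigD1 m)//=; left.
elim/big_ind: _ => // [E1 E2 H1 H2 [/H1|/H2]//|m _ ym].
by exists m.
Qed.

(** * From fixed indices to the selected one *)

Variable mhat : 'rV[R]_n -> M.
Hypothesis mhat_sel : selection top S beta_ alpha tau eta mhat.

Lemma measurable_mhat (A : set M) : measurable (mhat @^-1` A).
Proof.
have [mmhat _ _] := mhat_sel.
rewrite (_ : _ @^-1` _ = \bigcup_(m in A) (mhat @^-1` [set m])).
  by apply: fin_bigcup_measurable => //; exact: finite_finset.
by apply/seteqP; split => y /=; [move=> Ay; exists (mhat y)|case=> m Am /= ->].
Qed.

(** Wherever the ball misses [f], the selected index is accepted and misses it, so [E] and the
    failure events cover the whole space. *)
Lemma coverage_prob f :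
  ((1 - \sum_m beta_ m)%:E <= gauss_law f sigma
     [set y | eball (fhat S mhat y)
                (rhohat top S beta_ alpha tau eta mhat y) f])%E.
Proof.
set E := mkset _.
have [mbad pbad] := bad_union_prob f.
have mE : measurable E.
  (* On each level set of [mhat] the projection and the radius come from a fixed index. *)
  rewrite (_ : E = \bigcup_(m in [set: M]) (mhat @^-1` [set m] `&`
      [set y | enorm (f - orthoproj (S m) y) <= radius m])).
    apply: fin_bigcup_measurable => [|m _]; first exact: finite_finset.
    by apply: measurableI; [exact: measurable_mhat|exact: measurable_covered].
  apply/seteqP; split => y; first by exists (mhat y).
  by case=> m _ [/= <-].
rewrite EFinB leeBlDr// -(probability_setT (gauss_law f sigma)).
apply: (@le_trans _ _ (gauss_law f sigma (E `|`
    \bigcup_(m in [set: M]) bad m f))).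
  apply: le_measure; rewrite ?inE//; first exact: measurableU.
  move=> y _; have [yE|yE] := pselect (E y); first by left.
  right; exists (mhat y) => //; have [_ acc _] := mhat_sel.
  by split; [exact: acc|rewrite ltNge; exact/negP].
by apply: le_trans (measureU2 _ mE mbad) _; rewrite leeD2l.
Qed.

Lemma radius_prob m f : f \in S m ->
  ((1 - alpha)%:E <= gauss_law f sigma
    [set y | (rhohat top S beta_ alpha tau eta mhat y <= radius m)%R])%E.
Proof.
move=> fS; apply: le_trans (accepted_prob_ge fS) _.
apply: le_measure; rewrite ?inE; first exact: measurable_accepted.
  exact: (measurable_mhat [set m' | radius m' <= radius m]).
by have [_ _ min] := mhat_sel; move=> y; exact: min.
Qed.

End confidence_ball.

Unset Implicit Arguments.

Theorem theorem3p2 (R : realType) (n : nat) (beta alpha tau eta sigma : R)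
    (M : finType) (top : M) (S : M -> {vspace 'rV[R]_n}) (beta_ : M -> R)
    (mhat : 'rV[R]_n -> M) :
  (0 < n)%N ->
  0 < beta < 1 ->
  0 < alpha < 1 - beta ->
  0 < tau ->
  0 <= eta < 1 ->
  noise_range tau eta sigma ->
  S top = fullv ->
  (forall m, m != top -> (\dim (S m) < n)%N) ->
  (forall m, 0 < beta_ m < 1) ->
  \sum_(m : M) beta_ m <= beta ->
  selection top S beta_ alpha tau eta mhat ->
  (forall f : 'rV[R]_n,
     ((1 - beta)%:E
      <= gauss_law f sigma
           [set y | eball (fhat S mhat y)
                      (rhohat top S beta_ alpha tau eta mhat y) f])%E)
  /\
  (forall m : M,
     ((1 - alpha)%:E
      <= ereal_inf
           [set gauss_law f sigma
                  [set y | (rhohat top S beta_ alpha tau eta mhat y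
                            <= conf_radius top S beta_ alpha tau eta m)%R]
           | f in [set f : 'rV[R]_n | f \in S m]])%E).
Proof.
move=> n0 /andP[b0 b1] /andP[a0 a1] tau0 eta01 sigmaI Stop dimS beta01 sumb sel.
have alpha01 : 0 < alpha < 1 by apply/andP; split => //; lra.
split=> [f|m].
  apply: le_trans; last exact: (coverage_prob n0 alpha01 tau0 eta01 sigmaI Stop
    dimS beta01 sel f).
  by rewrite lee_fin lerD2l lerN2.
apply: le_ereal_inf_tmp => _ [f fS <-].
exact: (radius_prob alpha01 tau0 eta01 sigmaI Stop dimS sel fS).
Qed.
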